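(* Let $G$ be a connected Lie group and let $K$ be a centered probability density on $G$ such that: (i) there is a neighborhood $W$ of the identity $e$ of $G$ with $\inf\{K(g): g\in W\}>0$; (ii) for every $k>0$, $\int_G dg\, K(g)e^{k\rho(g)}<\infty$. Let $Tf=K*f$. Then there exists $c>0$ such that $$|((I-T)f,f)|\le c\,\Gamma_2(f)^2\quad\text{for all } f\in L^2.$$
   Context: $\mathbb{N}=\{1,2,3,\dots\}$; $dg$ is a left Haar measure on $G$; $L^p=L^p(G;dg)$ (complex-valued); $(f_1,f_2)=\int_G dg\, f_1\overline{f_2}$. Convolution: $(f_1*f_2)(g)=\int_G dh\,f_1(h)f_2(h^{-1}g)$. A probability density on $G$ is a Borel measurable $K:G\to[0,\infty)$ with $\int_G dg\,K(g)=1$. Distance: fix a relatively compact, open, symmetric ($U=U^{-1}$) neighborhood $U$ of $e$ (which generates $G$), and set $\rho(g)=\inf\{n\in\mathbb{N}: g\in U^n\}$, where $U^n=\{g_1\cdots g_n: g_i\in U\}$. Gradient: $(L(g)f)(h)=f(g^{-1}h)$, $\partial_g=L(g)-I$, and $\Gamma_p(f)=\sup_{u\in U}\|\partial_u f\|_p$. Centered: let $G_0=\overline{[G,G]}$ be the closure of the commutator subgroup, $\pi_0:G\to G/G_0$ the canonical homomorphism. $G/G_0$ is a connected abelian Lie group, so $G/G_0\cong\mathbb{R}^q\times\mathbb{T}^r$ for some integers $q,r\ge0$, $\mathbb{T}=\mathbb{R}/\mathbb{Z}$. Put $G_1=\pi_0^{-1}(\{0\}\times\mathbb{T}^r)$,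 and let $\pi_1:G\to G/G_1\cong\mathbb{R}^q$ have components $\pi_1^{(i)}:G\to\mathbb{R}$. $K$ is centered if $\int_G dg\,K(g)\pi_1^{(i)}(g)=0$ for all $i\in\{1,\dots,q\}$. *)

(* Defs.v *)
From HB Require Import structures.
From mathcomp Require Import all_boot all_order all_algebra.
From mathcomp Require Import all_classical all_reals all_analysis.
From mathcomp Require Import generic_quotient ring_quotient complex.

Set Implicit Arguments.
Unset Strict Implicit.
Unset Printing Implicit Defensive.

Import Order.TTheory GRing.Theory Num.Theory numFieldNormedType.Exports.

Local Open Scope classical_set_scope.
Local Open Scope quotient_scope.
Local Open Scope ring_scope.

(* A pointed topology is required only because the library builds generated
   sigma-algebras on pointed types; the distinguished point plays no role. *)
HB.mixin Record isTopologicalGroup G & Group G & PointedTopological G := {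
  mulg_continuous : continuous (fun xy : G * G => (xy.1 * xy.2)%g);
  invg_continuous : continuous (fun x : G => (x^-1)%g)
}.

#[short(type="topGroupType")]
HB.structure Definition TopologicalGroup :=
  {G of Group G & PointedTopological G & isTopologicalGroup G}.

(* C^k and C^infty maps on an open subset D of a finite-dimensional space. *)
Fixpoint Ck_on (R : realType) (V W : normedModType R) (k : nat) (D : set V)
    (f : V -> W) : Prop :=
  match k with
  | 0 => forall x, D x -> {for x, continuous f}
  | k'.+1 => (forall x, D x -> differentiable f x) /\
             (forall v, Ck_on k' D ('D_v f))
  end.

Definition smooth_on (R : realType) (V W : normedModType R) (D : set V)
    (f : V -> W) := forall k, Ck_on k D f.

Section LieGroup.
Variables (R : realType) (G : topGroupType).

(* chart_inv is meaningful only on the image of chart_dom under chart_map. *)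
Record chart (n : nat) := Chart {
  chart_dom : set G;
  chart_map : G -> 'rV[R]_n;
  chart_inv : 'rV[R]_n -> G
}.

Definition chart_img n (c : chart n) : set 'rV[R]_n :=
  chart_map c @` chart_dom c.

Definition is_chart n (c : chart n) :=
  [/\ open (chart_dom c), open (chart_img c),
      forall x, chart_dom c x -> chart_inv c (chart_map c x) = x,
      forall x, chart_dom c x -> {for x, continuous (chart_map c)} &
      forall y, chart_img c y -> {for y, continuous (chart_inv c)}].

Definition smooth_atlas n (A : set (chart n)) :=
  [/\ forall c, A c -> is_chart c,
      forall x : G, exists2 c, A c & chart_dom c x &
      forall c d, A c -> A d ->
        smooth_on (chart_map c @` (chart_dom c `&` chart_dom d))
                  (chart_map d \o chart_inv c)].

Definition smooth_mul n (A : set (chart n)) :=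
  forall a b c, A a -> A b -> A c ->
    smooth_on
      [set xy : 'rV[R]_n * 'rV[R]_n |
        [/\ chart_img a xy.1, chart_img b xy.2 &
            chart_dom c (chart_inv a xy.1 * chart_inv b xy.2)%g]]
      (fun xy => chart_map c (chart_inv a xy.1 * chart_inv b xy.2)%g).

Definition smooth_inv n (A : set (chart n)) :=
  forall a b, A a -> A b ->
    smooth_on
      [set x : 'rV[R]_n | chart_img a x /\ chart_dom b ((chart_inv a x)^-1)%g]
      (fun x => chart_map b ((chart_inv a x)^-1)%g).

Definition lie_group :=
  [/\ hausdorff_space G, @second_countable G &
      exists n (A : set (chart n)),
        [/\ smooth_atlas A, smooth_mul A & smooth_inv A]].

End LieGroup.

Section Abelianization.
Variable G : topGroupType.

Definition is_subgroup (H : set G) :=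
  H 1%g /\ forall x y, H x -> H y -> H (x * y^-1)%g.

Definition commutator_subgroup : set G :=
  smallest is_subgroup [set z | exists x y : G, z = [~ x, y]%g].

Definition G0 : set G := closure commutator_subgroup.

Definition left_coset (H : set G) (x : G) : set G := [set (x * h)%g | h in H].

Definition same_coset (x y : G) : bool :=
  `[< left_coset G0 x = left_coset G0 y >].

Lemma same_coset_refl : reflexive same_coset.
Proof. by move=> x; apply/asboolP. Qed.

Lemma same_coset_sym : symmetric same_coset.
Proof. by move=> x y; apply/asboolP/asboolP => ->. Qed.

Lemma same_coset_trans : transitive same_coset.
Proof. by move=> y x z /asboolP xy /asboolP yz; apply/asboolP; rewrite xy. Qed.

Canonical same_coset_equiv :=
  EquivRel same_coset same_coset_refl same_coset_sym same_coset_trans.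

Definition GmodG0 := quotient_topology {eq_quot same_coset}.

HB.instance Definition _ := Topological.on GmodG0.

Definition pi0 (g : G) : GmodG0 := \pi_({eq_quot same_coset}) g.

End Abelianization.

(* R/Z: int_num_subdef is the predicate underlying Num.int, the set Z in R. *)
Definition RmodZ (R : realType) :=
  Quotient.quot ((@Num.int_num_subdef R : {pred R}) : zmodClosed R).

Definition circle (R : realType) := quotient_topology (RmodZ R).

HB.instance Definition _ (R : realType) := Topological.on (circle R).
HB.instance Definition _ (R : realType) :=
  GRing.Zmodule.copy (circle R) (RmodZ R).

Section Centered.
Variables (R : realType) (G : topGroupType) (q r : nat).

(* The group law of G/G_0 is the one for which pi0 is a homomorphism, so the
   third condition says that phi is a homomorphism. *)
Definition topgroup_iso (phi : GmodG0 G -> 'rV[R]_q * 'rV[circle R]_r) :=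
  [/\ continuous phi,
      exists psi, [/\ cancel phi psi, cancel psi phi & continuous psi] &
      forall x y : G, phi (pi0 (x * y)%g) = phi (pi0 x) + phi (pi0 y)].

(* Since G_1 is the kernel of the R^q-component of phi \o pi0, that component
   is the projection G -> G/G_1 = R^q. *)
Definition pi1 (phi : GmodG0 G -> 'rV[R]_q * 'rV[circle R]_r) (i : 'I_q)
  (g : G) : R := (phi (pi0 g)).1 ord0 i.

End Centered.

Definition borel (G : ptopologicalType) := g_sigma_algebraType (@open G).

Section Analysis.
Variables (R : realType) (G : topGroupType).
Variable mu : {measure set (borel G) -> \bar R}.

(* Regularity need not be imposed: it is automatic for Borel measures that are
   finite on compact sets when G is locally compact, Hausdorff and second
   countable, as Lie groups are. *)
Definition left_haar :=
  [/\ mu setT != 0%E,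
      forall C : set G, compact C -> (mu C < +oo)%E &
      forall (g : G) (A : set (borel G)), measurable A ->
        mu [set (g * a : G)%g | a in A] = mu A].

Definition probability_density (K : G -> R) :=
  [/\ measurable_fun [set: borel G] K, forall g, 0 <= K g &
      (\int[mu]_(g in [set: borel G]) (K g)%:E = 1)%E].

Definition centered (q r : nat)
    (phi : GmodG0 G -> 'rV[R]_q * 'rV[circle R]_r) (K : G -> R) :=
  forall i : 'I_q, (\int[mu]_(g in [set: borel G]) (K g * pi1 phi i g)%:E = 0)%E.

Definition set_pow (U : set G) (n : nat) : set G :=
  [set g | exists2 u : 'I_n -> G, forall i, U (u i) & g = (\prod_(i < n) u i)%g].

Definition rho (U : set G) (g : G) : R :=
  inf [set n%:R | n in [set n : nat | (0 < n)%N /\ set_pow U n g]].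

(* The norm of R[i] is R[i]-valued; this is the corresponding real number. *)
Definition cabs (z : R[i]) : R := ComplexField.Normc.normc z.

Definition cintegral (f : G -> R[i]) : R[i] :=
  Complex (\int[mu]_(g in [set: borel G]) complex.Re (f g))
          (\int[mu]_(g in [set: borel G]) complex.Im (f g)).

Definition cnorm (p : \bar R) (f : G -> R[i]) : \bar R :=
  Lnorm mu p (fun g : borel G => (cabs (f g))%:E).

Definition in_Lp (p : \bar R) (f : G -> R[i]) :=
  [/\ measurable_fun [set: borel G] (fun g => complex.Re (f g)),
      measurable_fun [set: borel G] (fun g => complex.Im (f g)) &
      (cnorm p f < +oo)%E].

Definition inner (f1 f2 : G -> R[i]) : R[i] :=
  cintegral (fun g => f1 g * conjc (f2 g)).

Definition convolution (f1 f2 : G -> R[i]) (g : G) : R[i] :=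
  cintegral (fun h => f1 h * f2 (h^-1 * g)%g).

Definition ltrans (g : G) (f : G -> R[i]) : G -> R[i] :=
  fun h => f (g^-1 * h)%g.

Definition partial (g : G) (f : G -> R[i]) : G -> R[i] := ltrans g f - f.

Definition Gamma (U : set G) (p : \bar R) (f : G -> R[i]) : \bar R :=
  ereal_sup [set cnorm p (partial u f) | u in U].

Definition T_op (K : G -> R) (f : G -> R[i]) : G -> R[i] :=
  convolution (fun h => (K h)%:C%C) f.

End Analysis.

(* Main.v *)
Require Import Defs.
From HB Require Import structures.
From mathcomp Require Import all_boot all_order all_algebra.
From mathcomp Require Import all_classical all_reals all_analysis.
From mathcomp Require Import generic_quotient ring_quotient finmap complex.
From mathcomp Require Import measurable_realfun lra ring.

Set Implicit Arguments.
Unset Strict Implicit.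
Unset Printing Implicit Defensive.

Import Order.TTheory GRing.Theory Num.Theory numFieldNormedType.Exports.

Local Open Scope classical_set_scope.
Local Open Scope ring_scope.

(* By Fubini, ((I - T)f, f) is the integral over h of
   K(h) ((f, f) - (L(h)f, f)).  The real part of the integrand is
   K(h) |L(h)f - f|^2 / 2, which is at most K(h) e^(2 rho(h)) Gamma_2(f)^2.
   For the imaginary part, psi(h) = Im (L(h)f, f) satisfies
   |psi(gh) - psi(g) - psi(h)| <= (|L(g)f - f|^2 + |L(h)f - f|^2) / 2, so it is
   additive up to an error of order Gamma_2(f)^2.  A compactness argument
   (ultralimits of normalized quasi-additive functions are additive, and
   quasi-additive functions are asymptotically equicontinuous at e) gives a
   homomorphism eta : G -> R with |psi - eta| = O(Gamma_2(f)^2) on U, with a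
   constant independent of f.  Every continuous homomorphism G -> R is a linear
   combination of the pi_1^(i), so the integral of K eta vanishes because K is
   centered, and its size, which is not controlled by Gamma_2(f), is
   irrelevant. *)

(** * Word length and quasi-additive functions *)

Lemma cvg_mulg (G : topGroupType) (T : Type) (F : set_system T) (f g : T -> G)
    (a b : G) : Filter F -> f @ F --> a -> g @ F --> b ->
  (f x * g x)%g @[x --> F] --> (a * b)%g.
Proof.
by move=> FF fa gb; exact: (cvg_comp2 fa gb (@mulg_continuous G (a, b))).
Qed.

Lemma mulgl_continuous (G : topGroupType) (a : G) :
  continuous (fun x : G => (a * x)%g).
Proof. by move=> x; apply: cvg_mulg; [exact: cvg_cst|exact: cvg_id]. Qed.

Lemma nbhs_mulgl (G : topGroupType) (a g : G) (A : set G) :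
  nbhs (a * g)%g A -> nbhs g [set x | A (a * x)%g].
Proof. exact: mulgl_continuous. Qed.

Section Words.
Variables (G : topGroupType) (U : set G).

Lemma set_pow0 (g : G) : set_pow U 0 g <-> g = 1%g.
Proof.
split=> [[u _ ->]|->]; first by rewrite big_ord0.
by exists (fun=> 1%g); [case|rewrite big_ord0].
Qed.

Lemma set_powS n (g : G) :
  set_pow U n.+1 g <-> exists h u, [/\ set_pow U n h, U u & g = (h * u)%g].
Proof.
split=> [[u Uu ->]|[h] [v] [] [u Uu ->] Uv ->].
  rewrite big_ord_recr /=; exists (\prod_(i < n) u (widen_ord (leqnSn n) i))%g.
  by exists (u ord_max); split=> //; exists (fun i => u (widen_ord (leqnSn n) i)).
exists (fun i : 'I_n.+1 => if insub (val i) is Some j then u j else v).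
  by move=> i; case: insubP.
rewrite big_ord_recr /=; case: insubP => /= [? |_]; first by rewrite ltnn.
congr (_ * _)%g; apply: eq_bigr => i _.
by case: insubP => [j _ /val_inj ->//|] /=; rewrite ltn_ord.
Qed.

Lemma set_pow1 (g : G) : set_pow U 1 g <-> U g.
Proof.
rewrite set_powS; split=> [[h] [u] [/set_pow0-> Uu ->]|Ug]; first by rewrite mul1g.
by exists 1%g, g; split=> //; [exact/set_pow0|rewrite mul1g].
Qed.

Hypothesis U_1 : U 1%g.

Hypothesis U_open : open U.

Lemma set_pow_open n : open (set_pow U n.+1).
Proof.
rewrite openE => g /set_powS [h [u [Uh Uu ->]]].
have /nbhs_mulgl nU : nbhs (h^-1 * (h * u))%g U.
  by rewrite mulgA mulVg mul1g; exact: open_nbhs_nbhs.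
rewrite /interior /=; apply: filterS nU => x /= Ux; rewrite set_powS; exists h, (h^-1 * x)%g.
by split=> //; rewrite mulgA mulgV mul1g.
Qed.

Hypothesis U_sym : forall g : G, U g^-1%g <-> U g.

(** The union of the positive powers of [U] is open and closed. If [x] lies in its closure, the
    neighborhood [x U] meets it in some [y], and [x] is [y] followed by the letter [(x^-1 * y)^-1],
    which is in [U] by symmetry. *)
Lemma set_pow_exhaust : connected [set: G] -> forall g, exists n, set_pow U n.+1 g.
Proof.
move=> conn g; pose H := [set g : G | exists n, set_pow U n.+1 g].
suff : H = setT by move=> HT; have : setT g by []; rewrite -HT.
apply: conn; first by exists 1%g, 0%N; apply/set_pow1.
  exists H; last by rewrite setTI.
  rewrite (_ : H = \bigcup_n set_pow U n.+1).
    by apply: bigcup_open => n _; exact: set_pow_open.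
  by apply/seteqP; split=> [x [n ?]|x [n _ ?]]; exists n.
exists H; last by rewrite setTI.
move=> x clHx.
have /nbhs_mulgl/clHx [y [[n Hy] /= Uxy]] : nbhs (x^-1 * x)%g U.
  by rewrite mulVg; exact: open_nbhs_nbhs.
exists n.+1; apply/set_powS; exists y, (x^-1 * y)^-1%g.
by split=> //; [exact/U_sym|rewrite invgM invgK mulgA mulgV mul1g].
Qed.

End Words.

(** * Stability of quasi-additive functions *)

Section QuasiAdditive.
Variables (R : realType) (G : topGroupType) (U : set G).
Implicit Types (psi eta : G -> R).

(* The growth factor 4 ^+ n is harmless because K has all exponential
   moments; it spares us the Cauchy-Schwarz and Minkowski inequalities. *)
Definition quasi_additive (D : R) psi := forall n g u,
  set_pow U n g -> U u -> `|psi (g * u)%g - psi g - psi u| <= 4 ^+ n * D.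

Definition additive_on_group eta := forall x y, eta (x * y)%g = eta x + eta y.

Definition bounded_by (S : R) psi := forall u, U u -> `|psi u| <= S.

Lemma additive1 eta : additive_on_group eta -> eta 1%g = 0.
Proof.
move=> etaD; have := etaD 1%g 1%g; rewrite mulg1 => /eqP.
by rewrite -subr_eq subrr eq_sym => /eqP.
Qed.

Lemma additiveV eta : additive_on_group eta -> forall x, eta x^-1%g = - eta x.
Proof.
move=> etaD x; apply/eqP; rewrite -addr_eq0 -etaD mulVg; exact/eqP/additive1.
Qed.

Lemma quasi_additiveB D psi eta : quasi_additive D psi ->
  additive_on_group eta -> quasi_additive D (psi \- eta).
Proof.
move=> Q etaD n g u Hg Uu /=; rewrite etaD.
apply: le_trans (Q _ _ _ Hg Uu).
by rewrite le_eqVlt; apply/orP; left; apply/eqP; congr `|_|; ring.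
Qed.

Lemma quasi_additiveZ D psi (a : R) : 0 <= a -> quasi_additive D psi ->
  quasi_additive (a * D) (fun g => a * psi g).
Proof.
move=> a0 Q n g u Hg Uu.
rewrite -!mulrBr normrM (ger0_norm a0) mulrCA ler_wpM2l //; exact: Q.
Qed.

Hypothesis U_1 : U 1%g.

Lemma quasi_additive_ge0 D psi : quasi_additive D psi -> 0 <= D.
Proof.
move=> Q; have := Q 0%N 1%g 1%g; rewrite expr0 mul1r => /(_ _ U_1) H.
by apply: le_trans (H _); rewrite ?set_pow0.
Qed.

Lemma bounded_ge0 S psi : bounded_by S psi -> 0 <= S.
Proof. by move=> /(_ _ U_1); apply: le_trans. Qed.

(** Appending a letter to a word of length [n] adds at most [4 ^+ n * D + S], which is no more than
    the bound already reached, so each letter at most doubles the bound. *)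
Lemma quasi_additive_pow D S psi : quasi_additive D psi -> bounded_by S psi ->
  forall n g, set_pow U n g -> `|psi g| <= 4 ^+ n * (D + S).
Proof.
move=> Q B; have D0 := quasi_additive_ge0 Q; have S0 := bounded_ge0 B.
elim=> [g /set_pow0 ->|n IH g /set_powS [h [u [Hh Uu ->]]]].
  by rewrite expr0 mul1r; apply: le_trans (B _ U_1) _; rewrite lerDr.
have {}IH := IH _ Hh; have := Q _ _ _ Hh Uu; have := B _ Uu.
have : 1 <= (4 : R) ^+ n by rewrite exprn_ege1// ler1n.
rewrite exprS; move: (4 ^+ n) (psi (h * u)%g) (psi h) (psi u) IH => a x y z.
rewrite !ler_norml => IH a1 Hz Hx; nra.
Qed.

Let sq (x : G) := (x * x)%g.

Lemma nbhs_iter_square k : nbhs (1%g : G) U ->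
  nbhs (1%g : G) [set h | forall j, (j <= k)%N -> U (iter j sq h)].
Proof.
move=> nU.
have cont j : (iter j sq h) @[h --> (1%g : G)] --> (1%g : G).
  elim: j => [|j IH] /=; first exact: cvg_id.
  by rewrite -[X in _ --> X]mulg1; apply: cvg_mulg.
elim: k => [|k IH].
  by have /= := nU; apply: filterS => h /= Uh [].
apply: filterS2 IH (cont k.+1 _ nU) => h /= H1 H2 j.
by rewrite leq_eqVlt => /orP[/eqP->//|]; rewrite ltnS => /H1.
Qed.

(* psi (h * h) is close to 2 * psi h, so psi is small at h as soon as the first
   iterated squares of h stay in U. *)
Lemma quasi_additive_small D S psi h : quasi_additive D psi -> bounded_by S psi ->
  (forall j, (j <= 3)%N -> U (iter j sq h)) -> `|psi h| <= S / 8 + 4 * D.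
Proof.
move=> Q B Uh.
have step j : (j <= 3)%N ->
    `|psi (iter j.+1 sq h) - 2 * psi (iter j sq h)| <= 4 * D.
  move=> j3; have Uj := Uh _ j3.
  have := Q 1%N _ _ ((set_pow1 U _).2 Uj); rewrite expr1 => /(_ _ Uj).
  by rewrite -addrA -opprD -mulr2n -[_ *+ 2]mulr_natl.
(* The three doublings start from one-letter words, hence the error [4 * D] in each; halving back
   gives [S / 8] plus [4 * D] times 1/2 + 1/4 + 1/8. *)
have := B _ (Uh 3%N isT).
move: (step 0%N isT) (step 1%N isT) (step 2%N isT).
rewrite [iter 0 _ _]/=; move: (iter 1 _ _) (iter 2 _ _) (iter 3 _ _) => x y z.
move: (psi x) (psi y) (psi z) (psi h) => {}x {}y {}z t; rewrite !ler_norml; lra.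
Qed.

(** If the first [k] iterated squares of [h] stay in [U], then 2^k |eta h| is at most [S]. This
    gives continuity at the identity, and additivity carries it to every [g]. *)
Lemma additive_continuous eta S : nbhs (1%g : G) U -> additive_on_group eta ->
  bounded_by S eta -> continuous eta.
Proof.
move=> nU etaD B g; apply/cvgrPdist_le => e e0.
have S0 := bounded_ge0 B.
have iterE h j : eta (iter j sq h) = 2 ^+ j * eta h.
  elim: j => [|j IH]; first by rewrite expr0 mul1r.
  by rewrite /= etaD IH exprS -mulrA mulr_natl mulr2n.
pose k := Num.bound (S / e).
have kS : S / e <= 2 ^+ k.
  apply: le_trans (ltW (archi_boundP _)) _; first by rewrite divr_ge0 // ltW.
  by rewrite -natrX ler_nat ltnW // ltn_expl.
have /nbhs_mulgl : nbhs (g^-1 * g)%g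
    [set h | forall j, (j <= k)%N -> U (iter j sq h)].
  by rewrite mulVg; exact: nbhs_iter_square.
apply: filterS => h /= /(_ k (leqnn k)) /B.
rewrite iterE etaD additiveV // normrM ger0_norm ?exprn_ge0 // => H.
rewrite distrC addrC -(ler_pM2l (_ : 0 < 2 ^+ k)) ?exprn_gt0 //.
by apply: le_trans H _; rewrite -ler_pdivrMr.
Qed.

Hypothesis U_relcompact : compact (closure U).
Hypothesis U_open : open U.
Hypothesis U_exhaust : forall g, exists n, set_pow U n g.

(** Finitely many translates [g V] cover the compact closure of [U], where [V] is the neighborhood
    on which [quasi_additive_small] applies. For [u] in [g V], [psi u] differs from [psi g] by
    [psi (g^-1 * u)], which is small, and by one defect. The net does not depend on [psi]. *)
Lemma quasi_additive_net : exists s : seq G, exists2 C : R, 0 <= C &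
  forall D S psi, quasi_additive D psi -> bounded_by S psi ->
  forall u, U u -> exists2 g, g \in s & `|psi u| <= `|psi g| + S / 8 + C * D.
Proof.
have nU : nbhs (1%g : G) U by exact: open_nbhs_nbhs.
pose V := [set h | forall j, (j <= 3)%N -> U (iter j sq h)].
have nV : nbhs (1%g : G) V by exact: nbhs_iter_square.
(* The interior makes this an open cover; its centers range over all of [G], so their word lengths
   [len g] enter the constant through their maximum [N]. *)
pose W g := interior [set x | V (g^-1 * x)%g].
have Wg g : W g g.
  suff /nbhs_mulgl : nbhs (g^-1 * g)%g V by [].
  by rewrite mulVg.
move: U_relcompact; rewrite compact_cover => /(_ G setT W) [|x _|s _ Us].
- by move=> g _; exact: open_interior.
- by exists x.
have [len lenP] := choice U_exhaust.
pose N := (\max_(g <- enum_fset s) len g)%N.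
exists (enum_fset s), (4 ^+ N + 4); first by rewrite addr_ge0 ?exprn_ge0.
move=> D S psi Q B u Uu.
have D0 := quasi_additive_ge0 Q.
have [g sg /interior_subset /= Vgu] := Us _ (subset_closure Uu).
exists g => //; have := quasi_additive_small Q B Vgu.
have /(Q _ _ _ (lenP g)) := Vgu 0%N isT.
rewrite [iter 0 _ _]/= mulgA mulgV mul1g.
have : 4 ^+ len g * D <= 4 ^+ N * D.
  rewrite ler_wpM2r // ler_weXn2l ?ler1n // /N.
  by rewrite (big_rem g) //= leq_max leqnn.
move: (4 ^+ len g * D) (psi (g^-1 * u)%g) => a x H1 H2 H3.
rewrite mulrDl.
have -> : psi u = (psi u - psi g - x) + (psi g + x) by ring.
apply: le_trans (ler_normD _ _) _; have := ler_normD (psi g) x; lra.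
Qed.

Lemma additive_of_generators eta : (forall g u, U u -> eta (g * u)%g = eta g + eta u) ->
  additive_on_group eta.
Proof.
move=> etaU x y.
have eta1 : eta 1%g = 0.
  have := etaU 1%g 1%g U_1; rewrite mulg1 => /eqP.
  by rewrite -subr_eq subrr eq_sym => /eqP.
have [n] := U_exhaust y.
elim: n y => [y /set_pow0 ->|n IH y /set_powS [h [u [Hh Uu ->]]]].
  by rewrite mulg1 eta1 addr0.
by rewrite mulgA (etaU (x * h)%g u Uu) IH// (etaU h u Uu) addrA.
Qed.

(** For each [g] the values [theta k g] are bounded in [k], so they converge along an ultrafilter
    refining the eventual filter; the defects tend to 0, so the limit is additive. The last clause
    hides the ultrafilter: it keeps only approximation on finite sets at arbitrarily large
    indices. *)
Lemma quasi_additive_limit (theta : nat -> G -> R) :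
  (forall k, quasi_additive k.+1%:R^-1 (theta k)) ->
  (forall k, bounded_by 1 (theta k)) ->
  exists eta, [/\ additive_on_group eta, bounded_by 1 eta &
    forall (s : seq G) (e : R) N, 0 < e -> exists2 k, (N <= k)%N &
      forall g, g \in s -> `|theta k g - eta g| <= e].
Proof.
move=> Q B; have [F [FU FN]] := ultraFilterLemma eventually_filter.
have lim g : exists l : R, forall e : R, 0 < e -> F [set k | `|theta k g - l| <= e].
  have [n Hn] := U_exhaust g; pose M : R := 4 ^+ n * (1 + 1).
  have tM k : `|theta k g| <= M.
    apply: le_trans (quasi_additive_pow (Q k) (B k) Hn) _.
    by rewrite ler_pM2l ?exprn_gt0// lerD2r invf_le1 ?ler1n ?ltr0n.
  have [] := @segment_compact R (- M) M ((fun k => theta k g) @ F).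
    apply: (@filterE _ F) => k.
    by change (is_true (theta k g \in `[- M, M])); rewrite in_itv /= -ler_norml; exact: tM.
  move=> l [_ cl]; exists l => e e0.
  (* Otherwise the complement belongs to the ultrafilter, and the cluster point [l] would have
     values at distance more than [e] inside its own [e]-ball. *)
  have [//|FC] := in_ultra_setVsetC [set k | `|theta k g - l| <= e] FU.
  have [x [/= Hx]] := cl (~` [set x | `|x - l| <= e]) _ FC (nbhsx_ballx l e e0).
  by rewrite /ball /= distrC => /ltW.
have [eta etaP] := choice lim; exists eta.
have Fs (s : seq G) (e : R) : 0 < e ->
    F [set k | forall g, g \in s -> `|theta k g - eta g| <= e].
  move=> e0; elim: s => [|g s IH]; first exact: filterE.
  apply: filterS2 (etaP g e e0) IH => k /= Hg Hs x.
  by rewrite inE => /orP[/eqP->//|/Hs].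
have pick (s : seq G) (e : R) N : 0 < e -> exists2 k, (N <= k)%N &
    forall g, g \in s -> `|theta k g - eta g| <= e.
  move=> e0; have FNN : F [set k | (N <= k)%N] by apply: FN; exact: nbhs_infty_ge.
  by have [k [? ?]] := filter_ex (filterI FNN (Fs s e e0)); exists k.
have etaU g u : U u -> eta (g * u)%g = eta g + eta u.
  move=> Uu; have [n Hn] := U_exhaust g.
  apply/eqP; rewrite -subr_eq0 -normr_le0; apply/ler_addgt0Pr => e e0; rewrite add0r.
  have e4 : 0 < e / 4 by rewrite divr_gt0.
  (* The error [e] is shared equally among the three approximated values and the defect, the latter
     being at most [4 ^+ n / k.+1%:R]. *)
  have [k Nk /= Hk] := pick [:: (g * u)%g; g; u] _ (Num.bound (4 ^+ n / (e / 4))) e4.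
  have := Hk g; have := Hk u; have := Hk (g * u)%g; rewrite !inE !eqxx !orbT.
  move=> /(_ isT) H1 /(_ isT) H2 /(_ isT) H3; have := Q k _ _ _ Hn Uu.
  have : 4 ^+ n / k.+1%:R <= e / 4.
    rewrite ler_pdivrMr ?ltr0n// mulrC -ler_pdivrMr//.
    apply: le_trans (ltW (archi_boundP _)) _; last by rewrite ler_nat ltnW.
    by rewrite divr_ge0 ?exprn_ge0// ltW.
  move: H1 H2 H3; move: (4 ^+ n / k.+1%:R) => a; rewrite !ler_norml.
  move: (theta k (g * u)%g) (theta k g) (theta k u) (eta (g * u)%g) (eta g) (eta u).
  move=> *; lra.
split=> //; first exact: additive_of_generators.
move=> u Uu; apply/ler_addgt0Pr => e e0.
have [k _ /(_ u)] := pick [:: u] e 0%N e0; rewrite inE eqxx => /(_ isT).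
have := B k u Uu; rewrite !ler_norml; lra.
Qed.

(* If this fails for C = k.+1 with witness psi_k, then the functions psi_k / S_k
   have an additive limit point eta, which is close to psi_k / S_k on a finite
   net of U for some large k, hence on U. *)
Lemma quasi_additive_halve : exists2 C : R, 0 < C &
  forall D S psi, quasi_additive D psi -> bounded_by S psi -> C * D <= S ->
  exists2 eta, additive_on_group eta /\ bounded_by S eta & bounded_by (S / 2) (psi \- eta).
Proof.
apply: contrapT => nex.
have bad k : exists D S psi, [/\ quasi_additive D psi, bounded_by S psi,
    k.+1%:R * D <= S & forall eta, additive_on_group eta -> bounded_by S eta ->
      ~ bounded_by (S / 2) (psi \- eta)].
  apply: contrapT => nk; apply: nex; exists k.+1%:R; first by rewrite ltr0n.
  move=> D S psi Q B DS; apply: contrapT => neta; apply: nk.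
  exists D, S, psi; split=> // eta etaD etaB H; apply: neta; by exists eta.
have [D /choice [S /choice [psi H]]] := choice bad.
have Q k : quasi_additive (D k) (psi k) by case: (H k).
have B k : bounded_by (S k) (psi k) by case: (H k).
have DS k : k.+1%:R * D k <= S k by case: (H k).
have far k : forall eta, additive_on_group eta -> bounded_by (S k) eta ->
  ~ bounded_by (S k / 2) (psi k \- eta) by case: (H k).
(* If [S k] were 0, the zero homomorphism would already satisfy the excluded bound. *)
have S0 k : 0 < S k.
  rewrite lt_def (bounded_ge0 (B k)) andbT; apply/eqP => Sk0.
  apply: (far k (fun=> 0)) => [x y|u _|u Uu]; first by rewrite addr0.
    by rewrite normr0 Sk0.
  by rewrite /= subr0; apply: le_trans (B k u Uu) _; rewrite Sk0 mul0r.
pose theta k g := (S k)^-1 * psi k g.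
have [|k|eta [etaD etaB app]] := @quasi_additive_limit theta.
- move=> k n g u Hg Uu.
  have Sk0 : 0 <= (S k)^-1 by rewrite invr_ge0 ltW.
  apply: le_trans (quasi_additiveZ Sk0 (Q k) Hg Uu) _.
  rewrite ler_wpM2l ?exprn_ge0// ler_pdivrMl// ler_pdivlMr ?ltr0n//.
  by rewrite mulrC.
- move=> u Uu; rewrite normrM gtr0_norm ?invr_gt0// ler_pdivrMl// mulr1; exact: B.
have [s [C C0 net]] := quasi_additive_net.
(* On [U] the net will bound [theta k \- eta] by 1/16 + 2/8 + 1/16 < 1/2: approximation on the net,
   one eighth of the crude bound 2, and [C] times the defect, which is small because [k] exceeds
   [C * 16]. *)
have [k Nk Hk] := app s (1 / 16) (Num.bound (C * 16)) ltac:(by rewrite divr_gt0).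
have thB : bounded_by 2 (theta k \- eta).
  move=> u Uu /=; have := etaB u Uu.
  have : `|theta k u| <= 1.
    rewrite normrM gtr0_norm ?invr_gt0// ler_pdivrMl// mulr1; exact: B.
  rewrite !ler_norml; lra.
have thQ : quasi_additive ((S k)^-1 * D k) (theta k \- eta).
  apply: quasi_additiveB => //; apply: quasi_additiveZ => //.
  by rewrite invr_ge0 ltW.
apply: (far k (fun g => S k * eta g)) => [x y|u Uu|u Uu].
- by rewrite etaD mulrDr.
- by rewrite normrM gtr0_norm// ler_piMr ?etaB// ltW.
have [g sg] := net _ _ _ thQ thB u Uu.
have {}Hk := Hk _ sg.
have CD : C * ((S k)^-1 * D k) <= 1 / 16.
  have kS : (S k)^-1 * D k <= k.+1%:R^-1.
    by rewrite ler_pdivrMl// ler_pdivlMr ?ltr0n// mulrC.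
  apply: le_trans (ler_wpM2l C0 kS) _.
  rewrite ler_pdivrMr ?ltr0n// mulrC mul1r -ler_pdivrMr ?invr_gt0// invrK.
  apply: le_trans (ltW (archi_boundP _)) _; first by rewrite mulr_ge0.
  by rewrite ler_nat ltnW.
rewrite /= in Hk * => Hu.
have -> : psi k u - S k * eta u = S k * (theta k u - eta u).
  by rewrite /theta mulrBr mulrA divff ?mul1r// gt_eqF.
rewrite normrM gtr0_norm// ler_pM2l//; lra.
Qed.

(** The halving step is iterated, subtracting a homomorphism each time, until the bound on [U] drops
    to [C * D]; subtraction leaves the defect unchanged. The initial bound [M] governs the number of
    iterations but not [C]. *)
Lemma quasi_additive_stability : exists2 C : R, 0 < C &
  forall D M psi, quasi_additive D psi -> bounded_by M psi ->
  exists eta M', [/\ additive_on_group eta, bounded_by M' eta &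
    bounded_by (C * D) (psi \- eta)].
Proof.
have [C C0 half] := quasi_additive_halve; exists C => // D M psi Q B.
have D0 := quasi_additive_ge0 Q.
(* For [D = 0] the target 0 need not be reached in finitely many halvings, but [psi] is then itself
   additive. *)
have [D00|Dpos] := eqVneq D 0.
  exists psi, M; split=> //.
    apply: additive_of_generators => g u Uu; have [n Hn] := U_exhaust g.
    apply/eqP; rewrite -subr_eq0 opprD addrA -normr_le0.
    by have := Q _ _ _ Hn Uu; rewrite D00 mulr0.
  by move=> u Uu /=; rewrite subrr normr0 mulr_ge0// ltW.
have CD : 0 < C * D by rewrite mulr_gt0// lt_def Dpos.
suff main k : forall psi', quasi_additive D psi' ->
    bounded_by (2 ^+ k * (C * D)) psi' ->
    exists eta M', [/\ additive_on_group eta, bounded_by M' eta &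
      bounded_by (C * D) (psi' \- eta)].
  apply: (main (Num.bound (M / (C * D)))) => // u Uu; apply: le_trans (B u Uu) _.
  rewrite -ler_pdivrMr//; apply: le_trans (ltW (archi_boundP _)) _.
    by rewrite divr_ge0 ?(bounded_ge0 B)// ltW.
  by rewrite -natrX ler_nat ltnW // ltn_expl.
elim: k => [psi' Q' B'|k IH psi' Q' B'].
  exists (fun=> 0), 0; split=> [x y|u _|u Uu /=]; first by rewrite addr0.
    by rewrite normr0.
  by rewrite subr0; have := B' u Uu; rewrite expr0 mul1r.
have [|eta [etaD etaB] Be] := half _ _ _ Q' B'.
  by rewrite ler_peMl ?exprn_ege1 ?ler1n// ltW.
have [||eta2 [M2 [eta2D eta2B Be2]]] := IH (psi' \- eta).
- exact: quasi_additiveB.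
- move=> u Uu; apply: le_trans (Be u Uu) _.
  by rewrite exprS mulrC !mulrA mulVf ?mul1r// pnatr_eq0.
exists (eta \+ eta2), (2 ^+ k.+1 * (C * D) + M2); split=> [x y|u Uu|u Uu] /=.
- by rewrite etaD eta2D addrACA.
- by apply: le_trans (ler_normD _ _) _; apply: lerD; [exact: etaB|exact: eta2B].
- by rewrite opprD addrA; exact: Be2.
Qed.

End QuasiAdditive.

(** * Continuous homomorphisms to the real line *)

Section ContinuousAdditive.
Variable R : realType.

Lemma continuous_additive_real (f : R -> R) : continuous f ->
  {morph f : x y / x + y} -> forall x, f x = x * f 1.
Proof.
move=> fc fD x; pose h y := f y - y * f 1.
(* h is additive and vanishes at 1, so it is 1-periodic, hence bounded, hence 0. *)
have hD : {morph h : x y / x + y} by move=> y z; rewrite /h fD; ring.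
have h1 : h 1 = 0 by rewrite /h mul1r subrr.
have h0 : h 0 = 0 by have := hD 0 0; rewrite addr0; lra.
have hN y : h (- y) = - h y by have := hD y (- y); rewrite subrr h0; lra.
have hnat y n : h (n%:R * y) = n%:R * h y.
  elim: n => [|n IH]; first by rewrite !mul0r.
  by rewrite -natr1 !mulrDl hD IH !mul1r.
have hint (m : int) : h m%:~R = 0.
  case: m => n; last rewrite NegzE mulrNz hN; rewrite -pmulrn -[_%:R]mulr1 hnat h1 ?mulr0 ?oppr0//.
have hc : continuous h.
  move=> y; apply: cvgB; first exact: fc.
  by apply: cvgM; [exact: cvg_id|exact: cvg_cst].
have [M hM] : exists M, forall y, `|h y| <= M.
  have [c _ cmax] := @EVT_max R (fun y => `|h y|) 0 1 ler01
    (continuous_subspaceT (fun y => continuous_comp (hc y) (@norm_continuous _ R _))).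
  exists (`|h c|) => y; have -> : h y = h (y - (Num.floor y)%:~R).
    by rewrite hD hN hint oppr0 addr0.
  apply: cmax; rewrite in_itv /= subr_ge0 floor_le /=.
  by have := floorD1_gt y; rewrite intrD; lra.
suff : h x = 0 by rewrite /h; lra.
apply/eqP; apply: contraT => hx.
have hx0 : 0 < `|h x| by rewrite normr_gt0.
have := hM ((Num.bound (M / `|h x|))%:R * x); rewrite hnat normrM normr_nat leNgt.
rewrite -ltr_pdivrMr// archi_boundP//.
by rewrite divr_ge0// (le_trans _ (hM 0)).
Qed.

Lemma continuous_additive_rV n (F : 'rV[R]_n -> R) : continuous F ->
  {morph F : x y / x + y} ->
  forall v, F v = \sum_i v ord0 i * F (delta_mx ord0 i).
Proof.
move=> Fc FD v.
have F0 : F 0 = 0 by have := FD 0 0; rewrite addr0; lra.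
rewrite {1}(row_sum_delta v) (big_morph F FD F0); apply: eq_bigr => i _.
pose f s := F (s *: delta_mx ord0 i).
have fc : continuous f.
  move=> s; apply: (continuous_comp (f := fun s : R => s *: delta_mx ord0 i)
    (g := F)); last exact: Fc.
  by apply: cvgZr_tmp; exact: cvg_id.
have fD : {morph f : x y / x + y} by move=> x y; rewrite /f scalerDl FD.
by rewrite -/(f _) (continuous_additive_real fc fD) /f scale1r.
Qed.

End ContinuousAdditive.

Lemma continuous_pair (T U V : topologicalType) (f : T -> U) (g : T -> V) :
  continuous f -> continuous g -> continuous (fun x => (f x, g x)).
Proof. by move=> fc gc x; exact: (cvg_pair (fc x) (gc x)). Qed.

(** * Real characters of [G] through the abelianization *)

Section Characters.
Variables (R : realType) (G : topGroupType).

(** The kernel of [eta] is a closed subgroup containing all commutators. *)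
Lemma additive_G0 (eta : G -> R) : continuous eta -> additive_on_group eta ->
  forall h, G0 h -> eta h = 0.
Proof.
move=> etac etaD; have eV := additiveV etaD; have e1 := additive1 etaD.
have cl : closed [set h | eta h = 0].
  by apply: (@preimage_closed _ _ eta [set x | x = 0]) => [x _|]; [exact: etac|exact: closed_eq].
suff : @commutator_subgroup G `<=` [set h : G | eta h = 0].
  by rewrite /G0 closureE => sub; exact: smallest_sub.
apply: smallest_sub.
  by split=> //= x y; rewrite etaD eV => -> ->; rewrite subr0.
move=> _ [x [y ->]] /=; rewrite commgEl conjgE !etaD !eV; ring.
Qed.

Lemma G0_1 : G0 (1%g : G).
Proof.
by apply: subset_closure => H [[H1 _] _].
Qed.

Lemma additive_same_coset (eta : G -> R) : continuous eta ->
  additive_on_group eta -> forall a b, same_coset a b -> eta a = eta b.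
Proof.
move=> etac etaD a b /asboolP ab.
have : left_coset (@G0 G) a a by exists 1%g; [exact: G0_1|rewrite mulg1].
by rewrite ab => -[h G0h <-]; rewrite etaD (additive_G0 etac etaD G0h) addr0.
Qed.

Lemma pi0_eq (a b : G) : pi0 a = pi0 b -> same_coset a b.
Proof. by move=> ab; apply/(@eqmodP _ (@same_coset_equiv G)). Qed.

(** By [additive_same_coset], [eta] descends to the abelianization and becomes, through [phi], a
    continuous additive map [xi] on the product of R^q and a torus. It is linear on the first factor
    and zero on the second. *)
Lemma additive_pi1 q r (phi : GmodG0 G -> 'rV[R]_q * 'rV[circle R]_r)
    (eta : G -> R) : topgroup_iso phi -> continuous eta ->
  additive_on_group eta ->
  exists a : 'I_q -> R, forall g, eta g = \sum_i a i * pi1 phi i g.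
Proof.
move=> [phic [psi [phiK psiK psic]] phiD] etac etaD.
pose xi w := eta (repr (psi w)).
have xic : continuous xi.
  move=> w; apply: (continuous_comp (f := psi) (g := eta \o repr)); first exact: psic.
  (* Although [repr] need not be continuous, its composite with [eta] is, since [eta] is constant on
     the cosets. *)
  apply: (@repr_comp_continuous _ _ _ eta) => // a b /eqP ab.
  exact/eqP/(additive_same_coset etac etaD)/pi0_eq.
have pi0K x : pi0 (repr x) = x :> GmodG0 G by exact: reprK.
have xiE g : xi (phi (pi0 g)) = eta g.
  rewrite /xi phiK; apply: (additive_same_coset etac etaD).
  exact/pi0_eq/pi0K.
have xiD : {morph xi : x y / x + y}.
  move=> x y; rewrite -{1}[x]psiK -{1}[y]psiK -(pi0K (psi x)) -(pi0K (psi y)).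
  by rewrite -phiD xiE etaD.
pose F (v : 'rV[R]_q) := xi (v, 0).
pose p (s : 'rV[R]_r) : 'rV[circle R]_r := map_mx (\pi_(RmodZ R))%qT s.
pose E (s : 'rV[R]_r) := xi (0, p s).
have FE v : F v = \sum_i v ord0 i * F (delta_mx ord0 i).
  apply: continuous_additive_rV => [x|x y]; last first.
    by rewrite /F -xiD; congr xi; congr pair; rewrite addr0.
  apply: (continuous_comp (f := fun v : 'rV[R]_q => (v, 0 : 'rV[circle R]_r))
    (g := xi)); last exact: xic.
  by apply: continuous_pair => y; [exact: cvg_id|exact: cst_continuous].
have EE v : E v = \sum_i v ord0 i * E (delta_mx ord0 i).
  apply: continuous_additive_rV => [x|x y]; last first.
    rewrite /E -xiD; congr xi; congr pair; first by rewrite addr0.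
    by apply/rowP => j; rewrite !mxE; exact: raddfD.
  apply: (continuous_comp (f := fun v : 'rV[R]_r => (0 : 'rV[R]_q, p v))
    (g := xi)); last exact: xic.
  apply: continuous_pair => y; first exact: cst_continuous.
  move=> A [P HP sub]; exists (fun i j => (\pi_(RmodZ R))%qT @^-1` P i j).
    have pic : continuous ((\pi_(RmodZ R))%qT : R -> circle R).
      by move=> t; exact: pi_continuous.
    by move=> i j; have := HP i j; rewrite mxE; exact: pic.
  by move=> w Hw; apply: sub => i j; rewrite mxE; exact: Hw.
(* The lift E of the circle component to R^r is linear and vanishes on Z^r. *)
have E0 t : xi (0, t) = 0.
  have -> : t = p (map_mx repr t) by apply/rowP => j; rewrite !mxE reprK.
  rewrite -/(E _) EE big1// => i _.
  suff -> : E (delta_mx ord0 i) = 0 by rewrite mulr0.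
  have p0 : p (delta_mx ord0 i) = 0.
    apply/rowP => j; rewrite !mxE eqxx /=.
    have <- : (\pi_(RmodZ R))%qT (0 : R) = 0 by exact: raddf0.
    have := @Quotient.idealrBE R
      ((@Num.int_num_subdef R : {pred R}) : zmodClosed R) (j == i)%:R 0.
    rewrite subr0.
    have -> : (j == i)%:R \in ((@Num.int_num_subdef R : {pred R}) : zmodClosed R).
      by change (((j == i)%:R : R) \is a Num.int); exact: intr_nat.
    by move=> /esym/eqP.
  rewrite /E p0; have := xiD 0 0; rewrite addr0.
  by move=> /eqP; rewrite -subr_eq subrr eq_sym => /eqP.
exists (fun i => F (delta_mx ord0 i)) => g.
have xisplit w : xi w = xi (w.1, 0) + xi (0, w.2).
  rewrite -xiD; congr xi; case: w => u v /=.
  by congr pair; rewrite ?addr0 ?add0r.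
rewrite -xiE xisplit E0 addr0 -/(F _) FE.
by apply: eq_bigr => i _; rewrite mulrC.
Qed.

End Characters.

(** * Haar measure *)

Section BorelGroup.
Variables (R : realType) (G : topGroupType).

Lemma open_borel (A : set G) : open A -> measurable (A : set (borel G)).
Proof. by move=> oA; exact: sub_sigma_algebra. Qed.

Lemma continuous_borel (f : G -> G) : continuous f ->
  measurable_fun [set: borel G] (f : borel G -> borel G).
Proof.
move=> /continuousP fc; apply: (@measurability _ _ _ (borel G) _ _ (@open G) erefl).
by move=> _ [A oA <-]; rewrite setTI; apply: open_borel; exact: fc.
Qed.

Lemma continuous_borel_real (f : G -> R) : continuous f ->
  measurable_fun [set: borel G] (f : borel G -> R).
Proof.
move=> /continuousP fc; apply: (measurability _ (RGenOpens.measurableE R)).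
move=> _ [_ [a [b ->] <-]]; rewrite setTI.
by apply: open_borel; apply: fc; exact: interval_open.
Qed.

(* The preimage of an open set is open, and second countability writes it as a
   countable union of open boxes, which lie in the product sigma-algebra. *)
Lemma measurable_divl : @second_countable G ->
  measurable_fun [set: borel G * borel G]
    (fun z => (z.1^-1 * z.2)%g : borel G).
Proof.
move=> [B Bcnt [Bopen Bbasis]]; apply: (@measurability _ _ _ (borel G) _ _ (@open G) erefl).
move=> _ [A oA <-]; rewrite setTI.
have cont : continuous (fun z : G * G => (z.1^-1 * z.2)%g).
  move=> z; apply: cvg_mulg; last exact: cvg_snd.
  by apply: continuous_comp; [exact: cvg_fst|exact: invg_continuous].
pose P := [set p : set G * set G | [/\ B p.1, B p.2 &
  p.1 `*` p.2 `<=` (fun z => (z.1^-1 * z.2)%g) @^-1` A]].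
have -> : (fun z : G * G => (z.1^-1 * z.2)%g) @^-1` A = \bigcup_(p in P) (p.1 `*` p.2).
  apply/seteqP; split=> [[x y] /= Axy|z [p [_ _ sub]]]; last exact: sub.
  have [[X Y] [/= nX nY] XY] := cont (x, y) _ (open_nbhs_nbhs (conj oA Axy)).
  have [U [BU Ux] UX] := Bbasis x X nX; have [V [BV Vy] VY] := Bbasis y Y nY.
  exists (U, V) => //; split=> //= -[u v] [/= Uu Vv].
  by apply: (XY (u, v)); split; [exact: UX|exact: VY].
have Pcnt : countable P.
  by apply: sub_countable (countableX Bcnt Bcnt); apply: subset_card_le => p [].
have /countable_injP [f finj] := Pcnt.
(* The injection [f] turns the union over the countable [P] into one over the naturals; each [Q n]
   has at most one element. *)
pose Q n := P `&` [set p | f p = n].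
have -> : \bigcup_(p in P) (p.1 `*` p.2) = \bigcup_n \bigcup_(p in Q n) (p.1 `*` p.2).
  apply/seteqP; split=> [z [p Pp pz]|z [n _ [p [Pp _] pz]]]; last by exists p.
  by exists (f p) => //; exists p.
apply: bigcupT_measurable => n.
have [[p [Pp fp]]|nQ] := pselect (exists p, Q n p); last first.
  rewrite bigcup0 ?measurable0// => p Qp; case: nQ; by exists p.
have -> : Q n = [set p].
  apply/seteqP; split=> [p' [Pp' fp']|_ ->//].
  by apply: finj; [exact: mem_set|exact: mem_set|rewrite (fp' : f p' = n) (fp : f p = n)].
rewrite bigcup_set1; case: Pp => B1 B2 _.
by apply: measurableX; apply: open_borel; exact: Bopen.
Qed.

End BorelGroup.

Section Haar.
Variables (R : realType) (G : topGroupType).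
Variable mu : {measure set (borel G) -> \bar R}.
Hypothesis mu_inv : forall (g : G) (A : set (borel G)), measurable A ->
  mu [set (g * a : G)%g | a in A] = mu A.

Local Notation B := [set: borel G].

(** Left translation with an arbitrary codomain, so that it serves real and extended real integrands
    alike. *)
Definition tau (h : G) (T : Type) (a : G -> T) : G -> T := fun g => a (h^-1 * g)%g.

Lemma measurable_mulgl (h : G) : measurable_fun B (fun g : borel G => (h * g)%g : borel G).
Proof.
by apply: (@continuous_borel G (fun g => h * g)%g); exact: mulgl_continuous.
Qed.

Lemma measurable_tau (h : G) d (T : measurableType d) (a : G -> T) :
  measurable_fun B a -> measurable_fun B (tau h a).
Proof. by move=> ma; exact: (measurableT_comp ma (measurable_mulgl h^-1%g)). Qed.

(** The push-forward of [mu] under translation by [h^-1] is [mu]: the preimage of [A] is the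
    translate [h A]. *)
Lemma ge0_integral_tau (h : G) (F : borel G -> \bar R) : measurable_fun B F ->
  (forall g, (0 <= F g)%E) ->
  (\int[mu]_(g in B) tau h F g = \int[mu]_(g in B) F g)%E.
Proof.
move=> mF F0; pose phi := fun g : borel G => (h^-1 * g)%g : borel G.
have mphi : measurable_fun B phi := measurable_mulgl h^-1%g.
apply: etrans (esym (ge0_integral_pushforward mphi mu measurableT mF (fun g _ => F0 g))) _.
apply: eq_measure_integral => A mA _ /=; rewrite -[RHS](mu_inv h)//.
rewrite /pushforward; congr (mu _); apply/seteqP; split=> [x Ax|_ [x Ax <-]].
  by exists (h^-1 * x)%g => //; rewrite mulgA mulgV mul1g.
by rewrite /preimage /= /phi mulgA mulVg mul1g.
Qed.

Lemma integral_tau (h : G) (F : borel G -> \bar R) : measurable_fun B F ->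
  (\int[mu]_(g in B) tau h F g = \int[mu]_(g in B) F g)%E.
Proof.
move=> mF; rewrite integralE [in RHS]integralE.
rewrite -(ge0_integral_tau h (F := F^\+%E))//; last exact: measurable_funepos.
rewrite -(ge0_integral_tau h (F := F^\-%E))//; last exact: measurable_funeneg.
rewrite -[tau h F]/(F \o (fun g : G => (h^-1 * g)%g)).
by rewrite funepos_comp funeneg_comp.
Qed.

Lemma Rintegral_tau (h : G) (a : G -> R) : measurable_fun B a ->
  \int[mu]_(g in B) tau h a g = \int[mu]_(g in B) a g.
Proof.
by move=> /measurable_EFinP ma; rewrite /Rintegral -(integral_tau h ma).
Qed.

Definition L2 (a : G -> R) := measurable_fun B a /\
  (\int[mu]_(g in B) ((a g) ^+ 2)%:E < +oo)%E.

Definition ip (a b : G -> R) : R := \int[mu]_(g in B) (a g * b g).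

Definition Rconvolution (K a : G -> R) (g : G) : R :=
  \int[mu]_(h in B) (K h * a (h^-1 * g)%g).

Lemma L2_sqr_integrable a : L2 a -> mu.-integrable B (fun g => ((a g) ^+ 2)%:E).
Proof.
move=> [ma a2]; apply/integrableP; split.
  by apply/measurable_EFinP; exact: measurable_funX.
by under eq_integral do rewrite gee0_abs ?lee_fin ?sqr_ge0//.
Qed.

Lemma L2_mul_integrable a b : L2 a -> L2 b ->
  mu.-integrable B (EFin \o (fun g : borel G => a g * b g)).
Proof.
move=> La Lb; have ab := integrableD measurableT (L2_sqr_integrable La) (L2_sqr_integrable Lb).
apply: le_integrable ab => //.
  by apply/measurable_EFinP; apply: measurable_funM; [case: La|case: Lb].
move=> g _; rewrite /= lee_fin [leRHS]ger0_norm ?addr_ge0 ?sqr_ge0//.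
rewrite normrM -[a g ^+ 2]real_normK ?num_real// -[b g ^+ 2]real_normK ?num_real//.
have := sqr_ge0 (`|a g| - `|b g|); have := normr_ge0 (a g); have := normr_ge0 (b g).
move: `|a g| `|b g| => x y; nra.
Qed.

Lemma L2B a b : L2 a -> L2 b -> L2 (a \- b).
Proof.
move=> La Lb; split; first by apply: measurable_funB; [case: La|case: Lb].
have [mI] := integrableP _ _ _ (integrableD measurableT
  (integrableZl measurableT 2 (L2_sqr_integrable La))
  (integrableZl measurableT 2 (L2_sqr_integrable Lb))).
apply: le_lt_trans; apply: ge0_le_integral => //.
- by move=> g _; rewrite lee_fin sqr_ge0.
- by apply/measurable_EFinP; apply: measurable_funX; apply: measurable_funB; [case: La|case: Lb].
- exact: measurableT_comp.
move=> g _ /=.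
rewrite /= lee_fin ger0_norm; last first.
  by rewrite addr_ge0// mulr_ge0// sqr_ge0.
by have := sqr_ge0 (a g + b g); move: (a g) (b g) => x y; nra.
Qed.

Lemma L2_tau h a : L2 a -> L2 (tau h a).
Proof.
move=> [ma a2]; split; first exact: measurable_tau.
rewrite (integral_tau h (F := fun g => ((a g) ^+ 2)%:E))//.
by apply/measurable_EFinP; exact: measurable_funX.
Qed.

Lemma ipC a b : ip a b = ip b a.
Proof. by rewrite /ip; under eq_Rintegral do rewrite mulrC. Qed.

Lemma ipBl a b c : L2 a -> L2 b -> L2 c -> ip (a \- b) c = ip a c - ip b c.
Proof.
move=> La Lb Lc; rewrite /ip -RintegralB//; [|exact: L2_mul_integrable..].
by apply: eq_Rintegral => g _ /=; rewrite mulrBl.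
Qed.

Lemma ipBr a b c : L2 a -> L2 b -> L2 c -> ip a (b \- c) = ip a b - ip a c.
Proof. by move=> La Lb Lc; rewrite ipC ipBl// ipC (ipC c). Qed.

Lemma ip_ge0 a : 0 <= ip a a.
Proof. by apply: Rintegral_ge0 => g _; rewrite -expr2 sqr_ge0. Qed.

Lemma ip_tau h a b : L2 a -> L2 b -> ip (tau h a) (tau h b) = ip a b.
Proof.
move=> [ma _] [mb _]; rewrite /ip -(Rintegral_tau h (a := fun g => a g * b g))//.
exact: measurable_funM.
Qed.

Lemma tau_tau g h (T : Type) (a : G -> T) : tau g (tau h a) = tau (g * h)%g a.
Proof. by apply/funext => x; rewrite /tau invgM mulgA. Qed.

Lemma tau1 (T : Type) (a : G -> T) : tau 1%g a = a.
Proof. by apply/funext => x; rewrite /tau invg1 mul1g. Qed.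

Lemma ip_tau_adj h a b : L2 a -> L2 b -> ip (tau h a) b = ip a (tau h^-1%g b).
Proof.
move=> La Lb; rewrite -[RHS](ip_tau h) ?tau_tau ?mulgV ?tau1//; exact: L2_tau.
Qed.

(** Both [a - b] and [a + b] have a nonnegative square integral. *)
Lemma ip_le a b : L2 a -> L2 b -> `|ip a b| <= (ip a a + ip b b) / 2.
Proof.
move=> La Lb; have := ip_ge0 (a \- b); rewrite ipBl ?ipBr//; [|exact: L2B].
have Lz : L2 (fun=> 0).
  split; first exact: measurable_cst.
  by rewrite integral0_eq// => x _; rewrite expr0n.
have Lbn : L2 ((fun=> 0) \- b) by exact: L2B.
have z c : L2 c -> ip c (fun=> 0) = 0.
  by move=> Lc; rewrite /ip /Rintegral integral0_eq// => x _; rewrite mulr0.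
have := ip_ge0 (a \- ((fun=> 0) \- b)); rewrite ipBl ?ipBr ?ipBl ?ipBr//; [|exact: L2B..].
rewrite !(ipC (fun=> 0)) !z// (ipC b a) ler_norml; lra.
Qed.

End Haar.

(** * Fubini for the pairing of a convolution with [b] *)

Section FubiniConvolution.
Variables (R : realType) (G : topGroupType).
Variable mu : {sigma_finite_measure set (borel G) -> \bar R}.
Hypothesis mu_inv : forall (g : G) (A : set (borel G)), measurable A ->
  mu [set (g * a : G)%g | a in A] = mu A.
Hypothesis G_sc : @second_countable G.
Variable K : G -> R.
Hypotheses (mK : measurable_fun [set: borel G] K) (K_ge0 : forall g, 0 <= K g).
Hypothesis K_fin : (\int[mu]_(g in [set: borel G]) (K g)%:E < +oo)%E.
Variables a b : G -> R.
Hypotheses (La : L2 mu a) (Lb : L2 mu b).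

Local Notation B := [set: borel G].

Let Phi (z : borel G * borel G) : R := K z.1 * a (z.1^-1 * z.2)%g.
Let F (z : borel G * borel G) : \bar R := (Phi z * b z.2)%:E.

Let mPhi : measurable_fun setT Phi.
Proof.
apply: measurable_funM; first exact: (measurableT_comp mK measurable_fst).
have [ma _] := La; exact: (measurableT_comp ma (measurable_divl G_sc)).
Qed.

Let mF : measurable_fun setT F.
Proof.
have [mb _] := Lb; apply/measurable_EFinP; apply: measurable_funM => //.
exact: (measurableT_comp mb measurable_snd).
Qed.

Let K_int : mu.-integrable B (EFin \o (K : borel G -> R)).
Proof.
apply/integrableP; split; first exact/measurable_EFinP.
by under eq_integral do rewrite /= ger0_norm//.
Qed.

(** A product is at most the sum of the squares, and translation invariance makes the integral of
    the squares independent of [h]. Integrability of [K] then yields that of [F] on the product. *)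
Let inner_le h : (\int[mu]_g `|F (h, g)| <=
  (K h)%:E * (ip mu a a + ip mu b b)%:E)%E.
Proof.
have Lt : L2 mu (tau h a) by exact: L2_tau.
have ab : mu.-integrable B (fun g => (((tau h a g) ^+ 2)%:E + ((b g) ^+ 2)%:E)%E).
  by apply: integrableD => //; exact: L2_sqr_integrable.
have sq c : L2 mu c -> (\int[mu]_g ((c g) ^+ 2)%:E = (ip mu c c)%:E)%E.
  move=> Lc; rewrite /ip /Rintegral fineK//.
  exact: integrable_fin_num (L2_mul_integrable Lc Lc).
have -> : ((ip mu a a + ip mu b b)%:E = \int[mu]_g (((tau h a g) ^+ 2)%:E + ((b g) ^+ 2)%:E))%E.
  by rewrite integralD//; [rewrite !sq// ip_tau|exact: L2_sqr_integrable..].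
rewrite -ge0_integralZl ?lee_fin//; last 2 first.
- exact: measurable_int ab.
- by move=> g _; rewrite adde_ge0// lee_fin sqr_ge0.
apply: ge0_le_integral => //.
- apply: measurableT_comp => //; exact: (measurableT_comp mF (measurable_pair1 h)).
- exact: measurable_funeM (measurable_int _ ab).
move=> g _; rewrite /F /Phi /= -/(tau h a g) -EFinM lee_fin.
rewrite -mulrA normrM (ger0_norm (K_ge0 h)) ler_wpM2l// normrM.
rewrite -[tau h a g ^+ 2]real_normK ?num_real// -[b g ^+ 2]real_normK ?num_real//.
have := sqr_ge0 (`|tau h a g| - `|b g|); have := normr_ge0 (tau h a g).
have := normr_ge0 (b g); move: `|tau h a g| `|b g| => x y; nra.
Qed.

Let F_int : (mu \x mu)%E.-integrable setT F.
Proof.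
apply/(integrable12ltyP mu mu) => //.
apply: (@le_lt_trans _ _ (\int[mu]_h ((K h)%:E * (ip mu a a + ip mu b b)%:E))%E).
  apply: ge0_le_integral => //.
  - by move=> h _; exact: integral_ge0.
  - apply: (measurable_fun_fubini_tonelli_F (abse \o F)) => //=.
    exact: measurableT_comp.
  - have mKc : measurable_fun B (EFin \o (fun h : borel G => K h * (ip mu a a + ip mu b b))).
      by apply/measurable_EFinP; exact: measurable_funM.
    exact: mKc.
by rewrite integralZr// muleC lte_mul_pinfty// lee_fin addr_ge0// ip_ge0.
Qed.

Let fubini_FE h : fubini_F mu F h = (K h * ip mu (tau h a) b)%:E.
Proof.
have I := L2_mul_integrable (L2_tau mu_inv h La) Lb.
rewrite /fubini_F /ip /Rintegral EFinM fineK; last exact: integrable_fin_num I.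
rewrite -integralZl//; apply: eq_integral => g _.
by rewrite /F /Phi /= -mulrA EFinM.
Qed.

Lemma convolution_ip_integrable :
  mu.-integrable B (EFin \o (fun h : borel G => K h * ip mu (tau h a) b)).
Proof.
have := integrable_fubini_F F_int; apply: eq_integrable => // h _; exact: fubini_FE.
Qed.

(** Tonelli applies to the positive and negative parts separately, and their difference is the
    integral at every [g], even where the section is not integrable. *)
Let m_Rconv : measurable_fun B (Rconvolution mu K a).
Proof.
rewrite /Rconvolution /Rintegral.
apply: measurableT_comp => //.
have := mPhi => /measurable_EFinP mP.
rewrite (_ : (fun g : borel G => _) = (fun g => \int[mu]_h ((EFin \o Phi)^\+ (h, g)))
   \- (fun g => \int[mu]_h ((EFin \o Phi)^\- (h, g))))%E.
  apply: emeasurable_funB.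
    apply: measurable_fun_fubini_tonelli_G => //; exact: measurable_funepos.
  apply: measurable_fun_fubini_tonelli_G => //; exact: measurable_funeneg.
apply/funext => g; rewrite integralE.
by congr (_ - _)%E; apply: eq_integral => h _; rewrite ?funeposE ?funenegE.
Qed.

(** For almost every [g] the section of [F] is integrable. If [b g] is nonzero, dividing by it shows
    that the convolution integral is finite, so [fine] loses nothing; if [b g] is 0, both sides
    vanish. *)
Let ae_G : ae_eq mu B (EFin \o (fun g : borel G => Rconvolution mu K a g * b g))
  (fubini_G mu F).
Proof.
have := ae_integrable2 F_int; apply: filterS => g Ig _.
rewrite /fubini_G /= /F /=.
have [b0|b0] := eqVneq (b g) 0.
  by rewrite b0 mulr0; under eq_integral do rewrite mulr0; rewrite integral0.
have IP : mu.-integrable B (fun h => (Phi (h, g))%:E).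
  have := integrableZl measurableT (b g)^-1 Ig; apply: eq_integrable => // h _.
  by rewrite /F /= -EFinM mulrC mulfK.
rewrite EFinM /Rconvolution /Rintegral fineK; last exact: integrable_fin_num IP.
by rewrite -integralZr//; apply: eq_integral => h _; rewrite EFinM.
Qed.

Lemma Rconvolution_mul_integrable :
  mu.-integrable B (EFin \o (fun g : borel G => Rconvolution mu K a g * b g)).
Proof.
have mA : measurable_fun B (EFin \o (fun g : borel G => Rconvolution mu K a g * b g)).
  by apply/measurable_EFinP; apply: measurable_funM; [exact: m_Rconv|case: Lb].
apply/integrableP; split => //.
have mG := measurable_fubini_G F_int.
apply: le_lt_trans ((integrable21ltyP mu mu mF).1 F_int).
have aeabs : ae_eq mu B (abse \o (EFin \o (fun g : borel G => Rconvolution mu K a g * b g)))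
    (abse \o fubini_G mu F).
  by move: ae_G; apply: filterS => g H Bg; congr abse; exact: H.
have mabs f : measurable_fun B f -> measurable_fun B (abse \o f : borel G -> \bar R).
  by move=> mf; exact: measurableT_comp.
rewrite (@ge0_ae_eq_integral _ _ _ mu B _ (abse \o fubini_G mu F) measurableT
  (mabs _ mA) (mabs _ mG) (fun _ _ => abse_ge0 _) (fun _ _ => abse_ge0 _) aeabs).
apply: ge0_le_integral => //.
- by move=> g _; exact: abse_ge0.
- exact: (mabs _ mG).
- apply: (measurable_fun_fubini_tonelli_G (abse \o F)) => //=.
  exact: measurableT_comp.
- move=> g _; apply: le_abse_integral => //.
  exact: (measurableT_comp mF (pair2_measurable g)).
Qed.

Lemma Rconvolution_mul : \int[mu]_(g in B) (Rconvolution mu K a g * b g) =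
  \int[mu]_(h in B) (K h * ip mu (tau h a) b).
Proof.
have mA := measurable_int _ Rconvolution_mul_integrable.
have mG := measurable_fubini_G F_int.
rewrite /Rintegral; congr fine.
rewrite (@ae_eq_integral _ _ _ mu B (fubini_G mu F) _ measurableT mA mG ae_G).
rewrite (integral21_prod_meas1 F_int).
rewrite -(integral12_prod_meas1 F_int); apply: eq_integral => h _.
exact: fubini_FE.
Qed.

End FubiniConvolution.

(** * Sigma-finiteness of Haar measure *)

Section SigmaFinite.
Variables (R : realType) (G : topGroupType).
Variable mu : {measure set (borel G) -> \bar R}.
Hypothesis mu_compact : forall C : set G, compact C -> (mu C < +oo)%E.
Hypothesis G_hausdorff : hausdorff_space G.
Variable U : set G.
Hypotheses (U_open : open U) (U_1 : U 1%g) (U_relcompact : compact (closure U)).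
Hypothesis U_exhaust : forall g, exists n, set_pow U n.+1 g.

Lemma set_pow_relcompact n : exists2 C : set G, compact C & set_pow U n `<=` C.
Proof.
elim: n => [|n [C cC UC]].
  by exists [set 1%g]; [exact: compact_set1|move=> g /set_pow0].
exists ((fun z : G * G => (z.1 * z.2)%g) @` (C `*` closure U)).
  apply: continuous_compact; last exact: compact_setX.
  by apply: continuous_subspaceT; exact: mulg_continuous.
move=> g /set_powS [h [u [/UC Ch Uu ->]]]; exists (h, u) => //; split=> //.
exact: subset_closure.
Qed.

(** The powers of [U] exhaust [G], and each lies in a compact set, hence has finite mass. *)
Lemma haar_sigma_finite : sigma_finite [set: borel G] mu.
Proof.
exists (fun n => set_pow U n.+1).
  by apply/seteqP; split=> // g _; have [n Hn] := U_exhaust g; exists n.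
move=> n; have mUn : measurable (set_pow U n.+1 : set (borel G)).
  by apply: open_borel; exact: set_pow_open.
split=> //; have [C cC UC] := set_pow_relcompact n.+1.
have mC : measurable (C : set (borel G)).
  rewrite -[C]setCK; apply: measurableC; apply: open_borel; apply: closed_openC.
  exact: compact_closed.
by apply: le_lt_trans (mu_compact cC); apply: le_measure; [exact: mem_set|exact: mem_set|].
Qed.

End SigmaFinite.

(** * Measurability of [rho] and comparison with powers of 4 *)

Section WordLength.
Variables (R : realType) (G : topGroupType) (U : set G).
Hypotheses (U_open : open U) (U_1 : U 1%g).
Hypothesis U_exhaust : forall g, exists n, set_pow U n.+1 g.

Lemma rho_le n g : set_pow U n.+1 g -> rho R U g <= n.+1%:R.
Proof.
move=> Hn; apply: ge_inf; last by exists n.+1.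
by exists 0 => _ [m _ <-].
Qed.

Lemma rho_attained g : exists2 n, set_pow U n.+1 g & rho R U g = n.+1%:R.
Proof.
have exP : exists n, `[< set_pow U n.+1 g >].
  by have [n Hn] := U_exhaust g; exists n; exact/asboolP.
case: (ex_minnP exP) => n /asboolP Hn nmin; exists n => //.
apply/eqP; rewrite eq_le rho_le//=; apply: lb_le_inf; first by exists n.+1%:R, n.+1.
move=> _ [[|m] [//= _ Hm] <-]; rewrite ler_nat ltnS; apply: nmin; exact/asboolP.
Qed.

Lemma measurable_rho : measurable_fun [set: borel G] (rho R U : borel G -> R).
Proof.
apply: (measurability _ (RGenInftyO.measurableE R)).
move=> _ [_ [y ->] <-]; rewrite setTI.
have -> : rho R U @^-1` `]-oo, y[%classic =
    \bigcup_(n in [set n | n.+1%:R < y]) set_pow U n.+1.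
  apply/seteqP; split=> [g|g [n /= ny Hn]].
    have [n Hn rg] := rho_attained g; rewrite /= in_itv /= rg => ny.
    by exists n.
  by rewrite /= in_itv /=; apply: le_lt_trans (rho_le Hn) ny.
by apply: bigcup_measurable => n _; apply: open_borel; exact: set_pow_open.
Qed.

(** Since e is at least 2, 4 is at most e^2. This converts the growth factor on words into an
    exponential weight of rate 2. *)
Lemma expr4_le_rho g : exists2 n, set_pow U n g & 4 ^+ n <= expR (2 * rho R U g).
Proof.
have [n Hn ->] := rho_attained g; exists n.+1 => //.
rewrite mulrC expRM_natl; apply: lerXn2r; rewrite ?nnegrE ?expR_ge0//.
have -> : (2 : R) = 1 + 1 by [].
rewrite expRD; have := expR_ge1Dx (1 : R); move: (expR _) => x; nra.
Qed.

End WordLength.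

(** * The sector estimate *)

Section Displacement.
Variables (R : realType) (G : topGroupType).
Variable mu : {measure set (borel G) -> \bar R}.
Hypothesis mu_inv : forall (g : G) (A : set (borel G)), measurable A ->
  mu [set (g * a : G)%g | a in A] = mu A.

Lemma ip_subsqr a b : L2 mu a -> L2 mu b ->
  ip mu (a \- b) (a \- b) = ip mu a a - 2 * ip mu a b + ip mu b b.
Proof.
move=> La Lb; rewrite ipBl ?ipBr//; [|exact: L2B].
rewrite (ipC mu b a); ring.
Qed.

Definition displ (a : G -> R) (h : G) : R := ip mu (tau h a \- a) (tau h a \- a).

Lemma displE a h : L2 mu a -> displ a h = 2 * ip mu a a - 2 * ip mu (tau h a) a.
Proof.
move=> La; have Lt := L2_tau mu_inv h La.
rewrite /displ ip_subsqr// ip_tau//; ring.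
Qed.

Lemma displV a h : L2 mu a -> displ a h^-1%g = displ a h.
Proof.
by move=> La; rewrite !displE// ip_tau_adj// invgK (ipC mu a).
Qed.

(** With [x] and [y] as below, [x + y] is the displacement by [g * h], and its squared norm is at
    most twice the sum of those of [x] and [y]. Invariance identifies the norm of [x] with the
    displacement by [h]. *)
Lemma displ_mul a g h : L2 mu a -> displ a (g * h)%g <= 2 * displ a g + 2 * displ a h.
Proof.
move=> La; have Lt k := L2_tau mu_inv k La.
pose x := tau (g * h)%g a \- tau g a; pose y := tau g a \- a.
have Lx : L2 mu x by exact: L2B.
have Ly : L2 mu y by exact: L2B.
have := ip_ge0 mu (x \- y); rewrite ip_subsqr// -/(displ a g).
have -> : ip mu x x = displ a h.
  have -> : x = tau g (tau h a \- a) by rewrite /x -tau_tau.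
  by rewrite ip_tau//; exact: L2B.
have -> : ip mu x y = ip mu (tau h a) a - ip mu (tau (g * h)%g a) a - ip mu a a + ip mu (tau g a) a.
  rewrite /x /y ipBl ?ipBr//.
  rewrite -tau_tau !(ip_tau mu_inv)//; ring.
rewrite !displE//; lra.
Qed.

Variables a b : G -> R.
Hypotheses (La : L2 mu a) (Lb : L2 mu b).

(* For f = a + i b these are |L(h) f - f|^2 and Im (L(h) f, f). *)
Definition displ2 h := displ a h + displ b h.
Definition imcoef h := ip mu (tau h b) a - ip mu (tau h a) b.

(* With d_g = L(g) - 1, this comes from d_(gh) - d_g - d_h = d_g d_h and
   (d_g d_h f, f) = (d_h f, d_(g^-1) f). *)
Lemma imcoef_defect g h :
  `|imcoef (g * h)%g - imcoef g - imcoef h| <= (displ2 g + displ2 h) / 2.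
Proof.
have La_ k := L2_tau mu_inv k La; have Lb_ k := L2_tau mu_inv k Lb.
have key c d : L2 mu c -> L2 mu d -> ip mu (tau h c \- c) (tau g^-1%g d \- d) =
    ip mu (tau (g * h)%g c) d - ip mu (tau h c) d - ip mu (tau g c) d + ip mu c d.
  move=> Lc Ld; have Lc_ k := L2_tau mu_inv k Lc; have Ld_ k := L2_tau mu_inv k Ld.
  rewrite ipBl ?ipBr//; last exact: L2B.
  rewrite -[ip mu (tau h c) (tau g^-1%g d)]ip_tau_adj// tau_tau.
  rewrite -[ip mu c (tau g^-1%g d)]ip_tau_adj//; ring.
have -> : imcoef (g * h)%g - imcoef g - imcoef h =
    ip mu (tau h b \- b) (tau g^-1%g a \- a) - ip mu (tau h a \- a) (tau g^-1%g b \- b).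
  rewrite !key// /imcoef (ipC mu b a); ring.
apply: le_trans (ler_normB _ _) _.
have := ip_le (L2B (Lb_ h) Lb) (L2B (La_ g^-1%g) La).
have := ip_le (L2B (La_ h) La) (L2B (Lb_ g^-1%g) Lb).
rewrite -!/(displ _ _) !displV// /displ2; lra.
Qed.

(** This bound depends on the norm of f, not on its gradient. It supplies the initial bound for
    [quasi_additive_stability], whose constant is independent of it. *)
Lemma imcoef_le u : `|imcoef u| <= ip mu a a + ip mu b b.
Proof.
apply: le_trans (ler_normB _ _) _.
have := ip_le (L2_tau mu_inv u Lb) La; have := ip_le (L2_tau mu_inv u La) Lb.
rewrite !(ip_tau mu_inv)//; lra.
Qed.

Variables (U : set G) (D : R).
Hypotheses (D_ge0 : 0 <= D) (UD : forall u, U u -> displ2 u <= D).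

(** Appending a letter turns [4 ^+ n * D] into at most [2 * (4 ^+ n * D) + 2 * D]; this recursion is
    where the base 4 comes from. *)
Lemma displ2_pow n g : set_pow U n g -> displ2 g <= 4 ^+ n * D.
Proof.
elim: n g => [g /set_pow0 ->|n IH g /set_powS [h [u [/IH Hh /UD Hu ->]]]].
  by rewrite /displ2 !displE// !tau1 expr0 mul1r !subrr addr0.
have := displ_mul h u La; have := displ_mul h u Lb.
have xD : D <= 4 ^+ n * D by rewrite ler_peMl// exprn_ege1// ler1n.
rewrite exprS -mulrA /displ2 in Hh Hu *; move: (4 ^+ n * D) xD Hh => x; lra.
Qed.

Lemma imcoef_quasi_additive : quasi_additive U D imcoef.
Proof.
move=> n g u Hg Uu; apply: le_trans (imcoef_defect g u) _.
have := displ2_pow Hg; have := UD Uu; have := D_ge0.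
have : 1 <= (4 : R) ^+ n by rewrite exprn_ege1// ler1n.
move: (4 ^+ n) => x; nra.
Qed.

End Displacement.

(** * From complex norms to real and imaginary parts *)

Section ComplexValued.
Variables (R : realType) (G : topGroupType).
Variable mu : {measure set (borel G) -> \bar R}.
Hypothesis mu_inv : forall (g : G) (A : set (borel G)), measurable A ->
  mu [set (g * a : G)%g | a in A] = mu A.

Local Notation Ref f := (fun g => complex.Re (f g)).
Local Notation Imf f := (fun g => complex.Im (f g)).

Lemma cabs_sqr (z : R[i]) : cabs z ^+ 2 = complex.Re z ^+ 2 + complex.Im z ^+ 2.
Proof. by case: z => x y; rewrite sqr_sqrtr// addr_ge0// sqr_ge0. Qed.

Lemma cabs_le (z : R[i]) : cabs z <= `|complex.Re z| + `|complex.Im z|.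
Proof.
rewrite -[leLHS]ger0_norm; last by case: z => x y; exact: sqrtr_ge0.
rewrite -ler_sqr ?nnegrE ?addr_ge0// real_normK ?num_real// cabs_sqr sqrrD.
by rewrite !real_normK ?num_real// lerD2r lerDl mulrn_wge0// mulr_ge0.
Qed.

Lemma cnorm2_sqr (f : G -> R[i]) : (cnorm mu 2%:E f ^+ 2 =
  \int[mu]_(g in [set: borel G]) (complex.Re (f g) ^+ 2 + complex.Im (f g) ^+ 2)%:E)%E.
Proof.
have -> : (cnorm mu 2%:E f ^+ 2 = cnorm mu 2%:E f `^ 2)%E.
  have := Lnorm_ge0 mu 2%:E (fun g : borel G => (cabs (f g))%:E).
  rewrite -/(cnorm mu 2%:E f); case: (cnorm mu 2%:E f) => [x x0|_|//].
    by rewrite poweR_EFin powR_mulrn// EFin_expe.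
  by rewrite poweRyr.
rewrite /cnorm poweR_Lnorm//; apply: eq_integral => g _.
by rewrite /= powR_mulrn ?normr_ge0// real_normK ?num_real// cabs_sqr.
Qed.

Lemma in_L2_Re_Im (f : G -> R[i]) : in_Lp mu 2%:E f ->
  L2 mu (Ref f) /\ L2 mu (Imf f).
Proof.
move=> [mr mi fin].
have fin2 : (\int[mu]_(g in [set: borel G])
    (complex.Re (f g) ^+ 2 + complex.Im (f g) ^+ 2)%:E < +oo)%E.
  by rewrite -cnorm2_sqr expe2 lte_mul_pinfty// ?ge0_fin_numE// Lnorm_ge0.
have msum : measurable_fun [set: borel G]
    (fun g : borel G => (complex.Re (f g) ^+ 2 + complex.Im (f g) ^+ 2)%:E).
  apply/measurable_EFinP; apply: measurable_funD; exact: measurable_funX.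
split; split=> //; apply: le_lt_trans fin2; apply: ge0_le_integral => //.
- by move=> g _; rewrite lee_fin sqr_ge0.
- by apply/measurable_EFinP; exact: measurable_funX.
- by move=> g _; rewrite lee_fin lerDl sqr_ge0.
- by move=> g _; rewrite lee_fin sqr_ge0.
- by apply/measurable_EFinP; exact: measurable_funX.
- by move=> g _; rewrite lee_fin lerDr sqr_ge0.
Qed.

Lemma cnorm2_partial (u : G) (f : G -> R[i]) : L2 mu (Ref f) -> L2 mu (Imf f) ->
  (cnorm mu 2%:E (partial u f) ^+ 2 = (displ2 mu (Ref f) (Imf f) u)%:E)%E.
Proof.
move=> La Lb; rewrite cnorm2_sqr.
have L c : L2 mu c -> L2 mu (tau u c \- c) by move=> Lc; apply: L2B => //; exact: L2_tau.
have fin c : L2 mu c ->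
    ((ip mu c c)%:E = \int[mu]_(g in [set: borel G]) ((c g) ^+ 2)%:E)%E.
  move=> Lc; rewrite /ip /Rintegral fineK//.
  exact: integrable_fin_num (L2_mul_integrable Lc Lc).
rewrite /displ2 EFinD /displ !fin; [|exact: L..].
rewrite -ge0_integralD//.
- apply: eq_integral => g _; rewrite -EFinD /tau.
  have -> : partial u f g = f (u^-1 * g)%g - f g by [].
  by rewrite /=; case: (f (u^-1 * g)%g) (f g) => [x y] [x' y'].
- by move=> g _; rewrite lee_fin sqr_ge0.
- exact: measurable_int (L2_sqr_integrable (L _ La)).
- by move=> g _; rewrite lee_fin sqr_ge0.
- exact: measurable_int (L2_sqr_integrable (L _ Lb)).
Qed.

Lemma displ2_le_Gamma (U : set G) (f : G -> R[i]) : L2 mu (Ref f) -> L2 mu (Imf f) ->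
  U 1%g -> Gamma mu U 2%:E f != +oo%E ->
  forall u, U u -> displ2 mu (Ref f) (Imf f) u <= fine (Gamma mu U 2%:E f) ^+ 2.
Proof.
move=> La Lb U1 Gfin u Uu.
have N_le v : U v -> (cnorm mu 2%:E (partial v f) <= Gamma mu U 2%:E f)%E.
  by move=> Uv; apply: ereal_sup_ubound; exists v.
(* As [U] contains the identity, the supremum is over a nonempty family of norms; it is thus
   nonnegative and, being finite, survives [fine]. *)
have G0 : (0 <= Gamma mu U 2%:E f)%E by apply: le_trans (N_le _ U1); exact: Lnorm_ge0.
have Gf : Gamma mu U 2%:E f \is a fin_num by rewrite ge0_fin_numE// ltey.
rewrite -lee_fin -cnorm2_partial// EFin_expe fineK//.
by rewrite !expe2 lee_pmul// ?Lnorm_ge0// N_le.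
Qed.

End ComplexValued.

(** * Integral formulas for the real and imaginary parts of ((I - T)f, f) *)

Section InnerProduct.
Variables (R : realType) (G : topGroupType).
Variable mu : {sigma_finite_measure set (borel G) -> \bar R}.
Hypothesis mu_inv : forall (g : G) (A : set (borel G)), measurable A ->
  mu [set (g * a : G)%g | a in A] = mu A.
Hypothesis G_sc : @second_countable G.
Variable K : G -> R.
Hypothesis K_density : probability_density mu K.
Variable f : G -> R[i].
Local Notation B := [set: borel G].
Let a g := complex.Re (f g).
Let b g := complex.Im (f g).
Hypotheses (La : L2 mu a) (Lb : L2 mu b).

Let mK : measurable_fun [set: borel G] K. Proof. by case: K_density. Qed.
Let K_ge0 g : 0 <= K g. Proof. by case: K_density. Qed.
Let K_fin : (\int[mu]_(g in [set: borel G]) (K g)%:E < +oo)%E.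
Proof. by case: K_density => _ _ ->; rewrite ltry. Qed.

Let cI c d (Lc : L2 mu c) (Ld : L2 mu d) :=
  convolution_ip_integrable mu_inv G_sc mK K_ge0 K_fin Lc Ld.
Let RI c d (Lc : L2 mu c) (Ld : L2 mu d) :=
  Rconvolution_mul_integrable mu_inv G_sc mK K_ge0 K_fin Lc Ld.
Let RE c d (Lc : L2 mu c) (Ld : L2 mu d) :=
  Rconvolution_mul mu_inv G_sc mK K_ge0 K_fin Lc Ld.

Lemma Re_T_op g : complex.Re (T_op mu K f g) = Rconvolution mu K a g.
Proof.
rewrite /T_op /convolution /cintegral /=; apply: eq_Rintegral => h _.
by rewrite /a; case: (f _) => x y /=; rewrite mul0r subr0.
Qed.

Lemma Im_T_op g : complex.Im (T_op mu K f g) = Rconvolution mu K b g.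
Proof.
rewrite /T_op /convolution /cintegral /=; apply: eq_Rintegral => h _.
by rewrite /b; case: (f _) => x y /=; rewrite mul0r addr0.
Qed.

Lemma Re_inner_sub_T_op : complex.Re (inner mu (f - T_op mu K f) f) =
  \int[mu]_(h in B) (K h * (displ2 mu a b h / 2)).
Proof.
pose A := Rconvolution mu K a; pose A' := Rconvolution mu K b.
have -> : complex.Re (inner mu (f - T_op mu K f) f) =
    \int[mu]_(g in B) ((a g * a g + b g * b g) - (A g * a g + A' g * b g)).
  apply: eq_Rintegral => g _; rewrite -[A g]Re_T_op -[A' g]Im_T_op /a /b.
  have -> : (f - T_op mu K f) g = f g - T_op mu K f g by [].
  by case: (f g) (T_op mu K f g) => [x y] [x' y'] /=; ring.
have iK : mu.-integrable B (EFin \o (K : borel G -> R)).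
  apply/integrableP; split; first exact/measurable_EFinP.
  by under eq_integral do rewrite /= ger0_norm//.
have K1 : \int[mu]_(h in B) K h = 1 by rewrite /Rintegral; case: K_density => _ _ ->.
pose E := ip mu a a + ip mu b b.
have i1 := cI La La; have i2 := cI Lb Lb.
have i3 : mu.-integrable B (EFin \o (fun h : borel G => K h * E)).
  have := integrableZl measurableT E iK; apply: eq_integrable => // h _.
  by rewrite /= -EFinM mulrC.
rewrite RintegralB//; last 2 first.
- by apply: (integrableD measurableT (L2_mul_integrable La La) (L2_mul_integrable Lb Lb)).
- by apply: (integrableD measurableT (RI La La) (RI Lb Lb)).
rewrite RintegralD//; [|exact: L2_mul_integrable..].
rewrite RintegralD//; [|exact: RI..].
rewrite !RE// -/(ip mu a a) -/(ip mu b b) -/E.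
(* Total mass 1 of [K] brings (f, f) under the integral over [h], where [displE] recombines the
   terms. *)
have -> : E = \int[mu]_(h in B) (K h * E) by rewrite RintegralZr// K1 mul1r.
rewrite -RintegralD// -RintegralB//; last by apply: (integrableD measurableT i1 i2).
by apply: eq_Rintegral => h _; rewrite /displ2 !displE// /E; field.
Qed.

(** Since (f, f) is real, only the cross terms between Tf and f contribute. *)
Lemma Im_inner_sub_T_op : complex.Im (inner mu (f - T_op mu K f) f) =
  - \int[mu]_(h in B) (K h * imcoef mu a b h).
Proof.
pose A := Rconvolution mu K a; pose A' := Rconvolution mu K b.
have -> : complex.Im (inner mu (f - T_op mu K f) f) =
    \int[mu]_(g in B) (A g * b g - A' g * a g).
  apply: eq_Rintegral => g _; rewrite -[A g]Re_T_op -[A' g]Im_T_op /a /b.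
  have -> : (f - T_op mu K f) g = f g - T_op mu K f g by [].
  by case: (f g) (T_op mu K f g) => [x y] [x' y'] /=; ring.
rewrite RintegralB//; [|exact: RI..].
rewrite !RE// -opprB -RintegralB//; [|exact: cI..].
by congr (- _); apply: eq_Rintegral => h _; rewrite /imcoef mulrBr.
Qed.

Lemma imcoef_mul_integrable :
  mu.-integrable B (EFin \o (fun h : borel G => K h * imcoef mu a b h)).
Proof.
have := integrableB measurableT (cI Lb La) (cI La Lb); apply: eq_integrable => // h _.
by rewrite /= -EFinB -mulrBr.
Qed.

Lemma displ2_mul_integrable :
  mu.-integrable B (EFin \o (fun h : borel G => K h * (displ2 mu a b h / 2))).
Proof.
have iK : mu.-integrable B (EFin \o (K : borel G -> R)).
  apply/integrableP; split; first exact/measurable_EFinP.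
  by under eq_integral do rewrite /= ger0_norm//.
have i3 := integrableZl measurableT (ip mu a a + ip mu b b) iK.
have := integrableB measurableT i3 (integrableD measurableT (cI La La) (cI Lb Lb)).
apply: eq_integrable => // h _; rewrite /=; congr EFin.
by rewrite /displ2 !displE//; field.
Qed.

End InnerProduct.

Lemma normr_Rintegral_le d (T : measurableType d) (R : realType)
    (mu : {measure set T -> \bar R}) (f g : T -> R) :
  mu.-integrable setT (EFin \o f) -> mu.-integrable setT (EFin \o g) ->
  (forall x, `|f x| <= g x) ->
  `|\int[mu]_x f x| <= \int[mu]_x g x.
Proof.
move=> fi gi fg; rewrite ler_norml -subr_ge0 opprK -[X in _ && X]subr_ge0.
rewrite -RintegralD// -RintegralB//.
by apply/andP; split; apply: Rintegral_ge0 => x _; have := fg x; rewrite ler_norml; lra.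
Qed.

(** * Integration against [K] and conclusion *)

Section SectorEstimate.
Variables (R : realType) (G : topGroupType).
Variable mu : {sigma_finite_measure set (borel G) -> \bar R}.
Hypothesis mu_inv : forall (g : G) (A : set (borel G)), measurable A ->
  mu [set (g * a : G)%g | a in A] = mu A.
Hypothesis G_sc : @second_countable G.
Variable U : set G.
Hypotheses (U_open : open U) (U_1 : U 1%g) (U_relcompact : compact (closure U)).
Hypothesis U_exhaust : forall g, exists n, set_pow U n.+1 g.
Variables (q r : nat) (phi : GmodG0 G -> 'rV[R]_q * 'rV[circle R]_r).
Hypothesis phi_iso : topgroup_iso phi.
Variable K : G -> R.
Hypotheses (K_density : probability_density mu K) (K_centered : centered mu phi K).
Hypothesis K_exp : (\int[mu]_(g in [set: borel G])
  (K g * expR (2 * rho R U g))%:E < +oo)%E.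

Local Notation B := [set: borel G].

Let nU : nbhs (1%g : G) U. Proof. exact: open_nbhs_nbhs. Qed.

Let K_ge0 g : 0 <= K g. Proof. by case: K_density. Qed.

Let W (h : G) : R := K h * expR (2 * rho R U h).

Let W_ge0 h : 0 <= W h. Proof. by rewrite mulr_ge0// expR_ge0. Qed.

Let W_int : mu.-integrable B (EFin \o (W : borel G -> R)).
Proof.
apply/integrableP; split.
  apply/measurable_EFinP; apply: measurable_funM; first by case: K_density.
  apply: measurableT_comp => //; apply: measurable_funM => //.
  exact: measurable_rho.
by under eq_integral do rewrite /= ger0_norm//.
Qed.

(** Turns a growth bound on words into a majorant by the integrable weight [W]. *)
Let pow_le_W (x : R) D h : (forall n, set_pow U n h -> x <= 4 ^+ n * D) -> 0 <= D ->
  K h * x <= D * W h.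
Proof.
move=> xD D0; have [n Hn n4] := expr4_le_rho R U_exhaust h.
rewrite /W mulrCA ler_wpM2l//; apply: le_trans (xD n Hn) _.
by rewrite mulrC ler_wpM2l.
Qed.

Lemma pi1_continuous i : continuous (pi1 phi i).
Proof.
have [phic _ _] := phi_iso; move=> g.
apply: (continuous_comp (f := fun g => (phi (pi0 g)).1)
  (g := fun v : 'rV[R]_q => v ord0 i)); last exact: coord_continuous.
apply: (continuous_comp (f := fun g => phi (pi0 g)) (g := fst)); last exact: cvg_fst.
apply: (continuous_comp (f := @pi0 G) (g := phi)); last exact: phic.
exact: pi_continuous.
Qed.

Lemma pi1_additive i : additive_on_group (pi1 phi i).
Proof. by have [_ _ phiD] := phi_iso => x y; rewrite /pi1 phiD mxE. Qed.

Lemma pi1_bounded i : exists M, bounded_by U M (pi1 phi i).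
Proof.
have cI : compact (pi1 phi i @` closure U).
  by apply: continuous_compact => //; apply: continuous_subspaceT; exact: pi1_continuous.
have [M [_ HM]] := compact_bounded cI; exists (M + 1) => u Uu.
by apply: (HM (M + 1)); [rewrite ltrDl|exists u => //; exact: subset_closure].
Qed.

(** A homomorphism bounded on [U] is quasi-additive with defect 0, so it grows at most like [4 ^+ n]
    and [W] dominates it after multiplication by [K]. *)
Let Kpi_int i : mu.-integrable B (EFin \o (fun h : borel G => K h * pi1 phi i h)).
Proof.
have [M MB] := pi1_bounded i; have M0 := bounded_ge0 U_1 MB.
have Q : quasi_additive U 0 (pi1 phi i).
  by move=> n g u _ _; rewrite pi1_additive mulr0 -addrA -opprD subrr normr0.
apply: le_integrable (integrableZl measurableT M W_int) => //.
  apply/measurable_EFinP; apply: measurable_funM; first by case: K_density.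
  apply: continuous_borel_real; exact: pi1_continuous.
move=> h _; rewrite /= lee_fin normrM (ger0_norm (K_ge0 h)).
rewrite [leRHS]ger0_norm ?mulr_ge0//; apply: pow_le_W => // n Hn.
by have := quasi_additive_pow U_1 Q MB Hn; rewrite add0r.
Qed.

Lemma centered_additive eta : continuous eta -> additive_on_group eta ->
  mu.-integrable B (EFin \o (fun h : borel G => K h * eta h)) /\
  \int[mu]_(h in B) (K h * eta h) = 0.
Proof.
move=> etac etaD; have [a etaE] := additive_pi1 phi_iso etac etaD.
pose F i (h : borel G) : \bar R := ((a i)%:E * (K h * pi1 phi i h)%:E)%E.
have FE h : (K h * eta h)%:E = (\sum_i F i h)%E.
  rewrite etaE mulr_sumr -sumEFin; apply: eq_bigr => i _.
  by rewrite /F -EFinM mulrCA.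
have iF i : mu.-integrable B (F i) by exact: (integrableZl measurableT (a i) (Kpi_int i)).
split.
  have := @integrable_sum _ _ _ mu B measurableT 'I_q (index_enum 'I_q) predT F (fun i _ => iF i).
  by apply: eq_integrable => // h _; rewrite /= FE.
rewrite /Rintegral; under eq_integral do rewrite FE.
rewrite integral_sum//= big1// => i _.
have -> : (\int[mu]_(h in B) F i h =
    (a i)%:E * \int[mu]_(h in B) (K h * pi1 phi i h)%:E)%E.
  by apply: integralZl => //; exact: Kpi_int.
by rewrite K_centered mule0.
Qed.

Lemma sector_estimate : exists2 c : R, 0 < c &
  forall f : G -> R[i], in_Lp mu 2%:E f ->
    ((cabs (inner mu (f - T_op mu K f) f))%:E
       <= c%:E * (Gamma mu U 2%:E f) ^+ 2)%E.
Proof.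
have ex g : exists n, set_pow U n g by have [n Hn] := U_exhaust g; exists n.+1.
have [C C0 stab] := @quasi_additive_stability R G U U_1 U_relcompact U_open ex.
pose I := \int[mu]_(h in B) W h.
have I0 : 0 <= I by apply: Rintegral_ge0.
(* The real part contributes [I] and the imaginary part [(1 + C) * I]; adding 1 ensures
   positivity. *)
exists ((2 + C) * I + 1).
  by rewrite ltr_pwDr// mulr_ge0// addr_ge0// ltW.
move=> f fL2; have [La Lb] := in_L2_Re_Im fL2.
set a := fun g => complex.Re (f g) in La; set b := fun g => complex.Im (f g) in Lb.
have [Goo|Gfin] := eqVneq (Gamma mu U 2%:E f) +oo%E.
  by rewrite Goo expe2 mulyy gt0_muley ?leey// lte_fin ltr_pwDr// mulr_ge0// addr_ge0// ltW.
have UD := displ2_le_Gamma mu_inv La Lb U_1 Gfin.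
have G0 : (0 <= Gamma mu U 2%:E f)%E.
  apply: ereal_sup_ge => //=.
  by exists (cnorm mu 2%:E (partial 1%g f)); [exists 1%g|exact: Lnorm_ge0].
rewrite -[Gamma mu U 2%:E f]fineK ?ge0_fin_numE ?ltey// -EFin_expe -EFinM lee_fin.
set D := _ ^+ 2 in UD *.
have D0 : 0 <= D by exact: sqr_ge0.
have WD k : mu.-integrable B (EFin \o (fun h : borel G => k * W h)).
  by have := integrableZl measurableT k W_int; apply: eq_integrable.
have Re_le : `|complex.Re (inner mu (f - T_op mu K f) f)| <= D * I.
  rewrite Re_inner_sub_T_op// -/a -/b /I -RintegralZl//.
  apply: normr_Rintegral_le => [||h].
  - exact: displ2_mul_integrable.
  - exact: WD.
  have d0 : 0 <= displ2 mu a b h by rewrite addr_ge0// ip_ge0.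
  rewrite normrM !ger0_norm ?divr_ge0//; apply: pow_le_W => // n Hn.
  have := displ2_pow mu_inv La Lb D0 UD Hn; lra.
have Im_le : `|complex.Im (inner mu (f - T_op mu K f) f)| <= (1 + C) * D * I.
  have Q := imcoef_quasi_additive mu_inv La Lb D0 UD.
  have [eta [M' [etaD etaB etaC]]] := stab _ _ _ Q (fun u _ => imcoef_le mu_inv La Lb u).
  have etac := additive_continuous U_1 nU etaD etaB.
  have [iKeta Keta] := centered_additive etac etaD.
  have iKs := imcoef_mul_integrable mu_inv G_sc K_density La Lb.
  rewrite Im_inner_sub_T_op// -/a -/b normrN.
  (* Subtracting the vanishing integral of [K eta] replaces [imcoef] by [imcoef \- eta], which has
     defect [D] and is bounded by [C * D] on [U]. *)
  rewrite -[X in `|X|]subr0 -Keta -RintegralB// /I -RintegralZl//.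
  apply: normr_Rintegral_le => [||h].
  - by have := integrableB measurableT iKs iKeta; apply: eq_integrable.
  - exact: WD.
  rewrite -mulrBr normrM (ger0_norm (K_ge0 h)).
  apply: pow_le_W => [n Hn|]; last by rewrite mulr_ge0// addr_ge0// ltW.
  have := quasi_additive_pow U_1 (quasi_additiveB Q etaD) etaC Hn.
  by rewrite mulrDl mul1r.
apply: le_trans (cabs_le _) _; apply: le_trans (lerD Re_le Im_le) _.
have -> : D * I + (1 + C) * D * I = (2 + C) * I * D by ring.
by rewrite ler_wpM2r// lerDl.
Qed.

End SectorEstimate.

Theorem theorem1p3 (R : realType) (G : topGroupType)
    (G_lie : lie_group R G) (G_conn : connected [set: G])
    (mu : {measure set (borel G) -> \bar R}) (mu_haar : left_haar mu)
    (U : set G) (U_open : open U) (U_1 : U 1%g)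
    (U_relcompact : compact (closure U))
    (U_sym : forall g : G, U g^-1%g <-> U g)
    (q r : nat) (phi : GmodG0 G -> 'rV[R]_q * 'rV[circle R]_r)
    (phi_iso : topgroup_iso phi)
    (K : G -> R) (K_density : probability_density mu K)
    (K_centered : centered mu phi K)
    (K_lower : exists2 W : set G, nbhs (1%g : G) W & 0 < inf (K @` W))
    (K_exp : forall k : R, 0 < k ->
      (\int[mu]_(g in [set: borel G]) (K g * expR (k * rho R U g))%:E < +oo)%E) :
  exists2 c : R, 0 < c &
    forall f : G -> R[i], in_Lp mu 2%:E f ->
      ((cabs (inner mu (f - T_op mu K f) f))%:E
         <= c%:E * (Gamma mu U 2%:E f) ^+ 2)%E.
Proof.
have [G_hausdorff G_sc _] := G_lie; have [_ mu_compact mu_inv] := mu_haar.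
have ex := set_pow_exhaust U_1 U_open U_sym G_conn.
have sf := haar_sigma_finite mu_compact G_hausdorff U_open U_relcompact ex.
(* The measure is repackaged with its sigma-finite structure, so that the product-measure results
   apply to it. *)
pose m1 := isSFinite.Build _ _ _ _ (sfinite_measure_sigma_finite sf).
pose m2 := isSigmaFinite.Build _ _ _ _ sf.
pose nu := HB.pack_for (SigmaFiniteMeasure.type (borel G) R) (Measure.sort mu) m1 m2.
have muE : mu = nu by exact: eq_measure.
have K2 := K_exp 2 (ltr0Sn _ 1).
move: K_density K_centered K2 mu_inv; rewrite muE => Kd Kc K2 mu_inv.
exact: (sector_estimate mu_inv G_sc U_open U_1 U_relcompact ex phi_iso Kd Kc K2).
Qed.
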